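(* Let $f$ be analytic on $\mathbb{D}$ with $\operatorname{Re} f>0$ on $\mathbb{D}$, $f'(0)=0$, and $f(0)$ a positive real number. Then there exists a positive Borel measure $\nu$ on $\widehat{\Theta}$ (of total mass $f(0)$) such that $$f(z)=\int_{\widehat{\Theta}} h_\vartheta(z)\,d\nu(\vartheta)\qquad(z\in\mathbb{D}).$$
   Context: $\widehat{\Theta}$ is the set of probability measures on the unit circle $\mathbb{T}$ of the following two kinds: (i) $\frac12(\delta_a+\delta_{-a})$ with $a\in\mathbb{T}$; (ii) $\lambda_1\delta_{w_1}+\lambda_2\delta_{w_2}+\lambda_3\delta_{w_3}$ with $w_1,w_2,w_3\in\mathbb{T}$ distinct, $0$ in the interior of the triangle with vertices $w_1,w_2,w_3$, and $(\lambda_1,\lambda_2,\lambda_3)$ the barycentric coordinates of $0$ with respect to these vertices. $\widehat{\Theta}$ carries the weak-* topology (as a subset of the dual of $C_{\mathbb{R}}(\mathbb{T})$). For $\vartheta\in\widehat\Theta$, $h_\vartheta(z)=\int_{\mathbb{T}}\frac{w+z}{w-z}\,d\vartheta(w)$. *)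

(* Defs.v *)
From HB Require Import structures.
From mathcomp Require Import all_boot all_order all_algebra.
From mathcomp Require Import all_classical all_reals all_analysis.
From mathcomp.real_closed Require Import complex.
Import Order.TTheory GRing.Theory Num.Theory.
Import numFieldNormedType.Exports.

Set Implicit Arguments.
Unset Strict Implicit.
Unset Printing Implicit Defensive.

Local Open Scope classical_set_scope.
Local Open Scope ring_scope.

(* The complex plane, with its normed/topological structure over itself
   (so that [derivable f z 1] is complex differentiability). *)
Definition CC (R : realType) := (R[i])^o.

Definition circle (R : realType) : set (CC R) := [set w | `|w| = 1].
Definition disc (R : realType) : set (CC R) := [set z | `|z| < 1].
Arguments circle : clear implicits.
Arguments disc : clear implicits.

(* A finite (probability) measure on T is identified with its integration
   functional  g |-> \int g d\vartheta, defined on all functions T -> C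
   (for finitely supported measures this functional determines the measure). *)
Definition functional (R : realType) := (CC R -> CC R) -> CC R.

Definition theta_kind1 (R : realType) (L : functional R) : Prop :=
  exists a : CC R, a \in circle R /\ L = (fun g => (g a + g (- a)) / 2).

Definition barycentric (R : realType) (w1 w2 w3 p : CC R) (l1 l2 l3 : R) :=
  l1 + l2 + l3 = 1 /\ l1%:C%C * w1 + l2%:C%C * w2 + l3%:C%C * w3 = p.

(* kind (ii): l1 delta_w1 + l2 delta_w2 + l3 delta_w3, w_i in T distinct,
   0 in the interior of the triangle w1 w2 w3 (i.e. the barycentric coordinates
   of 0 are all positive; the triangle is non degenerate since three distinct
   points of a circle are never collinear), l = barycentric coordinates of 0 *)
Definition theta_kind2 (R : realType) (L : functional R) : Prop :=
  exists (w1 w2 w3 : CC R) (l1 l2 l3 : R),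
    [/\ w1 \in circle R, w2 \in circle R & w3 \in circle R] /\
    [/\ w1 != w2, w1 != w3 & w2 != w3] /\
    barycentric w1 w2 w3 0 l1 l2 l3 /\
    [/\ 0 < l1, 0 < l2 & 0 < l3] /\
    L = (fun g => l1%:C%C * g w1 + l2%:C%C * g w2 + l3%:C%C * g w3).

Definition in_Theta (R : realType) (L : functional R) : Prop :=
  theta_kind1 L \/ theta_kind2 L.

Definition Theta (R : realType) := {L : functional R | in_Theta L}.

Definition theta_fun (R : realType) (t : Theta R) : functional R := proj1_sig t.

Lemma theta0_proof (R : realType) :
  in_Theta (fun g : CC R -> CC R => (g 1 + g (- 1)) / 2).
Proof.
left; exists 1; split => //.
by rewrite /circle inE /= normr1.
Qed.

Definition theta0 (R : realType) : Theta R := exist _ _ (theta0_proof R).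

HB.instance Definition _ (R : realType) := gen_eqMixin (Theta R).
HB.instance Definition _ (R : realType) := gen_choiceMixin (Theta R).
HB.instance Definition _ (R : realType) := isPointed.Build (Theta R) (theta0 R).

Definition theta_eval (R : realType) (g : CC R -> R) (t : Theta R) : R :=
  complex.Re (theta_fun t (fun w => (g w)%:C%C)).

(* weak-* topology on \widehat\Theta (as a subset of the dual of C_R(T)):
   the initial topology of the maps theta |-> \int g d theta, g in C_R(T);
   a set is open iff it contains a basic weak-* neighbourhood of each of its
   points. *)
Definition weakstar_open (R : realType) (A : set (Theta R)) : Prop :=
  forall t, A t ->
    exists (n : nat) (g : nat -> CC R -> R) (e : R),
      (forall i, (i < n)%N -> {within circle R, continuous (g i)}) /\ 0 < e /\
      [set s | forall i, (i < n)%N -> `|theta_eval (g i) s - theta_eval (g i) t| < e]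
        `<=` A.

Definition ThetaBorel (R : realType) := g_sigma_algebraType (@weakstar_open R).

Definition h_theta (R : realType) (t : Theta R) (z : CC R) : CC R :=
  theta_fun t (fun w => (w + z) / (w - z)).

(* Main.v *)
Require Import Defs.
From HB Require Import structures.
From mathcomp Require Import all_boot all_order all_algebra.
From mathcomp Require Import all_classical all_reals all_analysis.
From mathcomp.real_closed Require Import complex.
From mathcomp Require Import measurable_realfun ring lra zify.
Import Order.TTheory GRing.Theory Num.Theory.
Import numFieldNormedType.Exports.
Import Normc.

Set Implicit Arguments.
Unset Strict Implicit.
Unset Printing Implicit Defensive.

Local Open Scope classical_set_scope.
Local Open Scope ring_scope.

(** Everything is obtained as a limit of finite sums over the [2^n]-th roots of unity [w].

    A discrete form of Goursat's bisection argument, applied to [f / (id - z)] on the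
    contraction of a circle towards [z], gives Cauchy's formula as a limit of such sums.
    It follows that the measures with mass [Re f (r w) / 2^n] at [w] have Herglotz
    transforms tending to [f (r z)] and barycenters tending to [0] (because [f' 0 = 0]);
    one small extra atom makes the barycenter vanish exactly.

    A finite positive measure on the circle with barycenter [0] is a positive combination
    of such measures with at most three atoms: with more than three atoms one can move, in
    both directions, along the kernel of the three linear constraints until an atom
    disappears. The measures with three (possibly degenerate) atoms form a compact metric
    space mapping onto the elements of [Theta], hence a continuous image of the Cantor
    space. There a positive functional, taken here as an ultrafilter limit, is a measure:
    it is a finitely additive function on the cylinder sets, and by compactness it is
    trivially countably additive there. Its image on [Theta] is the required measure. *)

(** * Cauchy's formula as a limit of means over roots of unity *)

(** Two limits occur and their order matters: how fine the roots of unity must be depends on the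
    radius [r < 1], so the pairs of indices run along an iterated filter. An ultrafilter finer than
    it makes all limits exist at once, also for discontinuous test functions.

    The barycenter has to vanish exactly before the decomposition, because every element of [Theta]
    is exactly centered and a remainder could not be absorbed.

    Zero weights and coinciding points are allowed in triples so that they form a closed subset of a
    cube. Nothing outside [Theta] enters this way: a centered probability measure on at most two
    points of the circle is an antipodal pair with equal weights.

    The functional is carried to the Cantor space by an arbitrary, possibly discontinuous, section
    of the surjection. This is harmless, since the functions finally integrated factor through the
    surjection.

    Powers of two are used so that the sampling grid is compatible with bisection. The total mass
    comes out as [f 0] because the Herglotz kernel is [1] at [z = 0]. *)

Section ComplexNorm.
Variable R : realType.
Implicit Types x y z : R[i].

Lemma norm_normc x : `|x| = (normc x)%:C%C.
Proof. by []. Qed.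

Lemma normc_ge0 x : 0 <= normc x.
Proof. by case: x => a b; rewrite sqrtr_ge0. Qed.

Lemma normcB x y : normc (x - y) = normc (y - x).
Proof. by rewrite -normcN opprB. Qed.

Lemma ler_normcD x y (a b : R) :
  normc x <= a -> normc y <= b -> normc (x + y) <= a + b.
Proof. by move=> xa yb; apply: le_trans (le_normcD _ _) (lerD xa yb). Qed.

Lemma ler_normcB x y (a b : R) :
  normc x <= a -> normc y <= b -> normc (x - y) <= a + b.
Proof. by move=> xa yb; apply: ler_normcD; rewrite ?normcN. Qed.

Lemma ler_normcM x y (a b : R) :
  normc x <= a -> normc y <= b -> normc (x * y) <= a * b.
Proof. by move=> xa yb; rewrite normcM ler_pM ?normc_ge0. Qed.

Lemma ler_normc_sum (I : Type) (s : seq I) (F : I -> R[i]) :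
  normc (\sum_(i <- s) F i) <= \sum_(i <- s) normc (F i).
Proof.
elim: s => [|i s IH]; first by rewrite !big_nil normc0.
by rewrite !big_cons ler_normcD.
Qed.

Lemma ler_normc_sum_ord (m : nat) (F : nat -> R[i]) (e : R) :
  (forall k, (k < m)%N -> normc (F k) <= e) ->
  normc (\sum_(k < m) F k) <= m%:R * e.
Proof.
move=> Fe; apply: (le_trans (ler_normc_sum _ _)).
apply: (le_trans (y := \sum_(k < m) e)); first by apply: ler_sum => k _; exact: Fe.
by rewrite sumr_const card_ord mulr_natl.
Qed.

Lemma normc_real (a : R) : normc a%:C%C = `|a|.
Proof. by rewrite /= expr0n addr0 sqrtr_sqr. Qed.

Lemma ler_Re_normc x : `|complex.Re x| <= normc x.
Proof. by have := normc_ge_Re x; rewrite norm_normc lecR. Qed.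

Lemma ler_Im_normc x : `|complex.Im x| <= normc x.
Proof.
have := ler_Re_normc (x * 'i%C); rewrite ReiNIm normrN normcM.
by rewrite [X in _ * X](_ : _ = 1) ?mulr1 //= expr0n add0r expr1n sqrtr1.
Qed.

Lemma ler_normc_ReIm (x : R[i]) : normc x <= `|complex.Re x| + `|complex.Im x|.
Proof.
case: x => a b /=; rewrite -[leRHS]ger0_norm ?addr_ge0 // -sqrtr_sqr.
rewrite ler_wsqrtr // sqrrD !real_normK ?num_real //.
have : 0 <= `|a| * `|b| by rewrite mulr_ge0. lra.
Qed.

Lemma ler_normc_subD x y : normc x - normc y <= normc (x + y).
Proof.
by rewrite lerBlDr; have := le_normcD (x + y) (- y); rewrite addrK normcN.
Qed.
End ComplexNorm.

(** * Riemann sums along discrete paths *)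

Section PathSum.
Variable R : realType.
Implicit Types (g : R[i] -> R[i]) (p : nat -> R[i]).

(** The left-endpoint Riemann sum of the contour integral of [g] along the points [p]. *)
Definition path_sum g p (m : nat) : R[i] := \sum_(k < m) g (p k) * (p k.+1 - p k).

Lemma path_sumD g p m m' :
  path_sum g p (m + m') = path_sum g p m + path_sum g (fun k => p (m + k)%N) m'.
Proof.
rewrite /path_sum -!(big_mkord xpredT (fun k => g (p k) * (p k.+1 - p k))).
rewrite (big_cat_nat (n := m)) ?leq_addr //=; congr (_ + _).
rewrite -{1}[m]add0n big_addn addKn big_mkord.
by apply: eq_bigr => k _; rewrite addnS addnC.
Qed.

Lemma eq_path_sum g p q m : (forall k, (k <= m)%N -> p k = q k) ->
  path_sum g p m = path_sum g q m.
Proof.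
by move=> pq; apply: eq_bigr => k _; rewrite !pq // ltnW.
Qed.

(* The path sum of an affine function is, up to the squares of the steps, the increment
   of its primitive. *)
Lemma path_sum_affine g p m (c D : R[i]) (e d : R) :
  (forall k, (k <= m)%N -> normc (g (p k) - c - D * p k) <= e) ->
  (forall k, (k < m)%N -> normc (p k.+1 - p k) <= d) ->
  normc (path_sum g p m - (c * (p m - p 0%N) + D / 2 * (p m ^+ 2 - p 0%N ^+ 2)))
    <= m%:R * (e * d + normc D * (d * d)).
Proof.
move=> ge pd.
pose F k := (g (p k) - c - D * p k) * (p k.+1 - p k)
            - D / 2 * ((p k.+1 - p k) * (p k.+1 - p k)).
have -> : path_sum g p m - (c * (p m - p 0%N) + D / 2 * (p m ^+ 2 - p 0%N ^+ 2))
    = \sum_(k < m) F k.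
  rewrite /path_sum; elim: m {ge pd} => [|m IH]; first by rewrite !big_ord0; ring.
  rewrite !big_ord_recr /= -IH /F; field; rewrite ?pnatr_eq0 //.
apply: (@ler_normc_sum_ord _ m F) => k km; rewrite /F.
apply: ler_normcB; first by rewrite ler_normcM ?ge ?pd // ltnW.
apply: ler_normcM; last by rewrite ler_normcM ?pd.
rewrite normcM ler_piMr ?normc_ge0 // normcV.
have -> : normc (2 : R[i]) = 2.
  by have := normc_real (2 : R); rewrite rmorph_nat normr_nat.
by rewrite invf_le1 ?ltr0n // ler1n.
Qed.
End PathSum.

(** * Goursat's theorem for Riemann sums over a bisected parameter square *)

Section Goursat.
Variable R : realType.

(** Complex differentiability with real [e], [d] and the real-valued modulus [normc], so that all
    estimates take place in [R]. *)
Definition cdiff (g : R[i] -> R[i]) (z : R[i]) := exists D, forall e : R, 0 < e ->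
  exists2 d : R, 0 < d & forall x, normc (x - z) < d ->
    normc (g x - g z - D * (x - z)) <= e * normc (x - z).

(** Left ends increase, right ends decrease, and every left end is below every right end; the
    supremum of the left ends lies in all the intervals. *)
Lemma nested_dyadic (a : nat -> nat) : a 0%N = 0%N ->
  (forall k, exists i : bool, a k.+1 = (a k).*2 + i)%N ->
  exists x : R, forall k, (a k)%:R / 2 ^+ k <= x <= (a k).+1%:R / 2 ^+ k.
Proof.
move=> a0 aS.
pose u k : R := (a k)%:R / 2 ^+ k; pose v k : R := (a k).+1%:R / 2 ^+ k.
have p2 k : (0 : R) < 2 ^+ k by rewrite exprn_gt0.
have uS k : u k <= u k.+1.
  rewrite /u exprS invfM mulrA ler_pM2r ?invr_gt0 // ler_pdivlMr //.
  by have [i ->] := aS k; rewrite -natrM ler_nat; lia.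
have vS k : v k.+1 <= v k.
  rewrite /v exprS invfM mulrA ler_pM2r ?invr_gt0 // ler_pdivrMr //.
  by have [i ->] := aS k; rewrite -natrM ler_nat; case: i; lia.
have uv k : u k <= v k by rewrite /u /v ler_pM2r ?invr_gt0 // ler_nat.
have umono j k : (j <= k)%N -> u j <= u k.
  by move=> /subnK <-; elim: (k - j)%N => // l IH; apply: le_trans IH (uS _).
have vmono j k : (j <= k)%N -> v k <= v j.
  by move=> /subnK <-; elim: (k - j)%N => // l IH; apply: le_trans (vS _) IH.
have ujvk j k : u j <= v k.
  case: (leqP j k) => [jk|/ltnW kj]; first exact: le_trans (umono _ _ jk) (uv _).
  exact: le_trans (uv _) (vmono _ _ kj).
have ub k : ubound [set u j | j in setT] (v k) by move=> _ [j _ <-].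
exists (sup [set u j | j in setT]) => k; apply/andP; split.
  apply: ub_le_sup; first by exists (v 0%N); exact: ub.
  by exists k.
by apply: ge_sup; [exists (u 0%N); exists 0%N | exact: ub].
Qed.

Section Box.
Variables (zeta : R -> R -> R[i]) (g : R[i] -> R[i]).

Definition grid n a b := zeta (a%:R / 2 ^+ n) (b%:R / 2 ^+ n).

(** The boundary sum, counterclockwise, of the image of a parameter square with [m] steps of length
    [2^-n] per side. The top and left sides are also sampled in increasing direction and then
    subtracted, so a side shared by two squares is sampled at the same points by both. *)
Definition box_sum n a b m : R[i] :=
  path_sum g (fun k => grid n (a + k) b) m
  + path_sum g (fun k => grid n (a + m) (b + k)) m
  - path_sum g (fun k => grid n (a + k) (b + m)) m
  - path_sum g (fun k => grid n a (b + k)) m.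

(** The inner sides cancel exactly, without any error term. *)
Lemma box_sum_split n a b m : box_sum n a b (m + m) =
  box_sum n a b m + box_sum n (a + m) b m
  + box_sum n a (b + m) m + box_sum n (a + m) (b + m) m.
Proof.
rewrite /box_sum !path_sumD.
have E p q : (forall k, p k = q k) -> path_sum g p m = path_sum g q m.
  by move=> pq; apply: eq_path_sum => k _.
rewrite (E (fun k => grid n (a + (m + k)) b) (fun k => grid n (a + m + k) b));
  last by move=> k; rewrite addnA.
rewrite (E (fun k => grid n (a + (m + m)) (b + k)) (fun k => grid n (a + m + m) (b + k)));
  last by move=> k; rewrite addnA.
rewrite (E (fun k => grid n (a + (m + m)) (b + (m + k)))
           (fun k => grid n (a + m + m) (b + m + k))); last by move=> k; rewrite !addnA.
rewrite (E (fun k => grid n (a + k) (b + (m + m))) (fun k => grid n (a + k) (b + m + m)));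
  last by move=> k; rewrite !addnA.
rewrite (E (fun k => grid n (a + (m + k)) (b + (m + m)))
           (fun k => grid n (a + m + k) (b + m + m))); last by move=> k; rewrite !addnA.
rewrite (E (fun k => grid n a (b + (m + k))) (fun k => grid n a (b + m + k)));
  last by move=> k; rewrite !addnA.
ring.
Qed.

(** An affine function has a primitive, whose increments along the four sides cancel around the
    square; each side leaves one error [q] of [path_sum_affine]. *)
Lemma box_sum_affine n a b m (c D : R[i]) (e d : R) :
  (forall i j, (i <= m)%N -> (j <= m)%N ->
     normc (g (grid n (a + i) (b + j)) - c - D * grid n (a + i) (b + j)) <= e) ->
  (forall i j, (i < m)%N -> (j <= m)%N ->
     normc (grid n (a + i).+1 (b + j) - grid n (a + i) (b + j)) <= d) ->
  (forall i j, (i <= m)%N -> (j < m)%N ->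
     normc (grid n (a + i) (b + j).+1 - grid n (a + i) (b + j)) <= d) ->
  normc (box_sum n a b m) <= 4 * (m%:R * (e * d + normc D * (d * d))).
Proof.
move=> ge hd vd.
set q := _ * (_ + _).
have H j : (j <= m)%N -> normc (path_sum g (fun k => grid n (a + k) (b + j)) m -
   (c * (grid n (a + m) (b + j) - grid n a (b + j))
     + D / 2 * (grid n (a + m) (b + j) ^+ 2 - grid n a (b + j) ^+ 2))) <= q.
  move=> jm; have := @path_sum_affine R g (fun k => grid n (a + k) (b + j)) m c D e d.
  rewrite /= addn0; apply => k km; first exact: ge.
  by rewrite addnS hd.
have V i : (i <= m)%N -> normc (path_sum g (fun k => grid n (a + i) (b + k)) m -
   (c * (grid n (a + i) (b + m) - grid n (a + i) b)
     + D / 2 * (grid n (a + i) (b + m) ^+ 2 - grid n (a + i) b ^+ 2))) <= q.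
  move=> im; have := @path_sum_affine R g (fun k => grid n (a + i) (b + k)) m c D e d.
  rewrite /= addn0; apply => k km; first exact: ge.
  by rewrite addnS vd.
have H0 := H 0%N (leq0n _); have V0 := V 0%N (leq0n _).
have Hm := H m (leqnn _); have Vm := V m (leqnn _).
rewrite !addn0 in H0 V0.
have := ler_normcB (ler_normcB (ler_normcD H0 Vm) Hm) V0.
rewrite (_ : q + q + q + q = 4 * q); last by ring.
congr (normc _ <= _); rewrite /box_sum; ring.
Qed.

End Box.
End Goursat.

Section GoursatTheorem.
Variable R : realType.
Variables (zeta : R -> R -> R[i]) (g : R[i] -> R[i]) (L : R).
Hypothesis zeta_lip : forall s t s' t', 0 <= s <= 1 -> 0 <= t <= 1 ->
  0 <= s' <= 1 -> 0 <= t' <= 1 ->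
  normc (zeta s t - zeta s' t') <= L * (`|s - s'| + `|t - t'|).
Hypothesis g_diff : forall s t, 0 <= s <= 1 -> 0 <= t <= 1 -> cdiff g (zeta s t).

Let pow2_gt0 k : (0 : R) < 2 ^+ k. Proof. by rewrite exprn_gt0. Qed.

(** The depth [k] of the box and the resolution [n] of the sum are independent. No limit in [n] is
    known to exist, so badness means that the bound fails at arbitrarily fine resolutions, a
    property that one of four children must inherit. *)
Definition bad_box (eps : R) k a b := forall n0, exists n,
  [/\ (n0 <= n)%N, (k <= n)%N &
   eps / 4 ^+ k < normc (box_sum zeta g n (a * 2 ^ (n - k)) (b * 2 ^ (n - k)) (2 ^ (n - k)))].

Lemma bad_box_child eps k a b : bad_box eps k a b ->
  exists i j : bool, bad_box eps k.+1 (a.*2 + i) (b.*2 + j).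
Proof.
move=> bad; apply: contrapT => nbad.
have good (i j : bool) : exists n0, forall n, (n0 <= n)%N -> (k < n)%N ->
    normc (box_sum zeta g n ((a.*2 + i) * 2 ^ (n - k.+1))
       ((b.*2 + j) * 2 ^ (n - k.+1)) (2 ^ (n - k.+1))) <= eps / 4 ^+ k.+1.
  apply: contrapT => ng; apply: nbad; exists i, j => n0.
  apply: contrapT => nn; apply: ng; exists n0 => n n0n kn.
  by rewrite leNgt; apply/negP => lt; apply: nn; exists n.
have [n1 g1] := good false false; have [n2 g2] := good true false.
have [n3 g3] := good false true; have [n4 g4] := good true true.
(* Beyond all four thresholds, and with [k < n] so that a side of [2 ^ (n - k)] steps can still be
   halved. The four bounds [eps / 4 ^+ k.+1] then add up to [eps / 4 ^+ k]. *)
have [n [hn kn]] := bad (n1 + n2 + n3 + n4 + k.+1)%N.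
apply/negP; rewrite -leNgt.
have kn' : (k < n)%N by lia.
have e2 : (2 ^ (n - k) = 2 ^ (n - k.+1) + 2 ^ (n - k.+1))%N.
  by rewrite addnn -mul2n -expnS; congr (2 ^ _)%N; lia.
rewrite e2 box_sum_split.
have := g1 n ltac:(lia) kn'; have := g2 n ltac:(lia) kn'.
have := g3 n ltac:(lia) kn'; have := g4 n ltac:(lia) kn'.
set m := (2 ^ _)%N; rewrite !addn0 !addn1.
have ea c : (c * (m + m) = c.*2 * m)%N by lia.
have eb c : (c.*2.+1 * m = c.*2 * m + m)%N by lia.
rewrite !ea !eb => h4 h3 h2 h1.
apply: le_trans (ler_normcD (ler_normcD (ler_normcD h1 h2) h3) h4) _.
rewrite exprS; set q := 4 ^+ k; have q0 : 0 < q by rewrite exprn_gt0.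
rewrite le_eqVlt; apply/orP; left; apply/eqP; field.
by rewrite gt_eqF.
Qed.

Lemma bad_box_chain eps : bad_box eps 0 0 0 -> exists a b : nat -> nat,
  [/\ a 0%N = 0%N, b 0%N = 0%N,
      (forall k, exists i : bool, a k.+1 = (a k).*2 + i)%N,
      (forall k, exists i : bool, b k.+1 = (b k).*2 + i)%N &
      forall k, bad_box eps k (a k) (b k)].
Proof.
move=> bad0.
(* [choice] wants a total relation, so a box that is not bad is given its lower left child by
   default. *)
have next (kp : nat * (nat * nat)) : exists q : nat * nat,
    exists i j : bool, [/\ q.1 = (kp.2.1.*2 + i)%N, q.2 = (kp.2.2.*2 + j)%N &
      bad_box eps kp.1 kp.2.1 kp.2.2 -> bad_box eps kp.1.+1 q.1 q.2].
  have [/bad_box_child[i [j h]]|nb] := pselect (bad_box eps kp.1 kp.2.1 kp.2.2).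
    by exists ((kp.2.1.*2 + i)%N, (kp.2.2.*2 + j)%N), i, j.
  by exists (kp.2.1.*2, kp.2.2.*2), false, false; rewrite !addn0.
have [F FP] := choice next.
pose c := fix c k := if k is l.+1 then F (l, c l) else (0, 0)%N.
have cb k : bad_box eps k (c k).1 (c k).2.
  elim: k => [//|k IH]; have [i [j [_ _]]] := FP (k, c k); exact.
exists (fun k => (c k).1), (fun k => (c k).2); split => // k.
  by have [i [j [e1 e2 _]]] := FP (k, c k); exists i.
by have [i [j [e1 e2 _]]] := FP (k, c k); exists j.
Qed.

(** A chain of bad boxes shrinks to one parameter point, at whose image [g] is affine up to a small
    multiple of the distance. Distance and side length are both of order [2^-k], so the sum over the
    box is small compared with [4^-k], against badness. *)
Lemma not_bad_box eps : 0 < eps -> ~ bad_box eps 0 0 0.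
Proof.
move=> eps0 /bad_box_chain[a [b [a0 b0 aS bS bad]]].
have [x xP] := nested_dyadic R a0 aS; have [y yP] := nested_dyadic R b0 bS.
have bnd (c : nat -> nat) : c 0%N = 0%N ->
    (forall k, exists i : bool, c k.+1 = (c k).*2 + i)%N -> forall k, (c k < 2 ^ k)%N.
  move=> c0 cS; elim=> [|k IH]; first by rewrite c0.
  by have [i ->] := cS k; rewrite expnS; case: i; lia.
have ab := bnd a a0 aS; have bb := bnd b b0 bS.
have x01 : 0 <= x <= 1 by have := xP 0%N; rewrite a0 expr0 !divr1.
have y01 : 0 <= y <= 1 by have := yP 0%N; rewrite b0 expr0 !divr1.
have [D DP] := g_diff x01 y01.
set z0 := zeta x y in DP.
have L0 : 0 <= L.
  have := @zeta_lip 0 0 1 1; rewrite !lexx !ler01 /= => /(_ erefl erefl erefl erefl).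
  move=> /(le_trans (normc_ge0 _)); rewrite !sub0r normrN normr1; lra.
(* The linear error will be [8 * L^2 * eps / M / 4^k]; this [M] makes it at most half of the allowed
   [eps / 4^k]. *)
pose M := 16 * (L * L) + 1.
have M0 : 0 < M by rewrite /M; have := mulr_ge0 L0 L0; lra.
have [d d0 dP] := DP (eps / M) (divr_gt0 eps0 M0).
(* Both coordinates of a point of the box are within [2^-k] of the limit point, so the Lipschitz
   bound puts the whole image box within [d] of [z0]. *)
have [k kP] : exists k : nat, L * (2 / 2 ^+ k) < d.
  have := @archi_boundP R (L * 2 / d); rewrite divr_ge0 ?mulr_ge0 ?(ltW d0) // => /(_ isT).
  set N := Num.Def.archi_bound _ => hN; exists N.
  rewrite mulrA ltr_pdivrMr // [ltRHS]mulrC.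
  rewrite ltr_pdivrMr // in hN; apply: (lt_le_trans hN).
  by rewrite ler_pM2r // -natrX ler_nat ltnW // ltn_expl.
(* With [k] fixed, a resolution this fine brings the quadratic error [4 |D| L^2 / (2^k 2^n)] below
   the other half of [eps / 4^k]. *)
have [n1 n1P] : exists n1 : nat, 8 * normc D * (L * L) * 2 ^+ k / eps < n1%:R.
  have := @archi_boundP R (8 * normc D * (L * L) * 2 ^+ k / eps).
  rewrite !(divr_ge0, mulr_ge0) ?normc_ge0 ?(ltW eps0) ?(ltW (pow2_gt0 _)) //.
  by move=> /(_ isT); exists (Num.Def.archi_bound (8 * normc D * (L * L) * 2 ^+ k / eps)).
have [n [n1n kn]] := bad k n1.
apply/negP; rewrite -leNgt.
set m := (2 ^ (n - k))%N.
have e2n : (2 : R) ^+ n = 2 ^+ k * m%:R.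
  by rewrite /m natrX -exprD; congr (_ ^+ _); lia.
have m0 : (0 : R) < m%:R by rewrite /m natrX.
have mnat : (2 ^ n = 2 ^ k * m)%N by rewrite /m -expnD; congr (_ ^ _)%N; lia.
have sc (c i : nat) : (c * m + i)%N%:R / 2 ^+ n = c%:R / 2 ^+ k + i%:R / 2 ^+ n :> R.
  rewrite natrD natrM mulrDl; congr (_ + _); rewrite e2n; field.
  by rewrite !gt_eqF // pow2_gt0.
have in01 (c i : nat) : (c < 2 ^ k)%N -> (i <= m)%N ->
    0 <= ((c * m + i)%N%:R / 2 ^+ n : R) <= 1.
  move=> ck im; apply/andP; split; first by rewrite divr_ge0 // ltW.
  by rewrite ler_pdivrMr // mul1r -natrX ler_nat mnat; nia.
have near (c i : nat) (u : R) : c%:R / 2 ^+ k <= u <= c.+1%:R / 2 ^+ k -> (i <= m)%N ->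
    `|(c * m + i)%N%:R / 2 ^+ n - u| <= 1 / 2 ^+ k.
  move=> /andP[u1 u2] im; rewrite sc.
  have i0 : (0 : R) <= i%:R / 2 ^+ n by rewrite divr_ge0 // ltW.
  have i1 : i%:R / 2 ^+ n <= (1 : R) / 2 ^+ k.
    have -> : i%:R / 2 ^+ n = i%:R / m%:R / 2 ^+ k :> R.
      by rewrite e2n; field; rewrite !gt_eqF.
    by rewrite ler_pM2r ?invr_gt0 // ler_pdivrMr // mul1r ler_nat.
  have u2' : u <= c%:R / 2 ^+ k + 1 / 2 ^+ k by rewrite -mulrDl natr1.
  rewrite ler_norml; apply/andP; split; lra.
have step (c : nat) : `|c.+1%:R / 2 ^+ n - c%:R / 2 ^+ n| = 1 / 2 ^+ n :> R.
  by rewrite -mulrBl -natr1 addrAC subrr add0r ger0_norm // divr_ge0 // ltW.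
pose c := g z0 - D * z0.
pose e := eps / M * (L * (2 / 2 ^+ k)); pose dd := L * (1 / 2 ^+ n).
have H := @box_sum_affine R zeta g n (a k * m) (b k * m) m c D e dd.
apply: le_trans (H _ _ _) _.
- move=> i j im jm; rewrite /grid.
  set p := zeta _ _.
  have pz : normc (p - z0) <= L * (2 / 2 ^+ k).
    apply: le_trans (zeta_lip (in01 _ _ (ab k) im) (in01 _ _ (bb k) jm) x01 y01) _.
    rewrite ler_wpM2l //; have := near _ _ _ (xP k) im; have := near _ _ _ (yP k) jm; lra.
  have -> : g p - c - D * p = g p - g z0 - D * (p - z0) by rewrite /c; ring.
  apply: le_trans (dP _ (le_lt_trans pz kP)) _.
  by rewrite /e ler_wpM2l // divr_ge0 // ltW.
- move=> i j im jm; rewrite /grid.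
  apply: le_trans (zeta_lip _ _ _ _) _.
  + by rewrite -addnS in01.
  + exact: in01.
  + by rewrite in01 // ltnW.
  + exact: in01.
  by rewrite subrr normr0 addr0 step.
- move=> i j im jm; rewrite /grid.
  apply: le_trans (zeta_lip _ _ _ _) _.
  + exact: in01.
  + by rewrite -addnS in01.
  + exact: in01.
  + by rewrite in01 // ltnW.
  by rewrite subrr normr0 add0r step.
have m1 : m%:R / 2 ^+ n = 1 / 2 ^+ k :> R.
  by rewrite e2n; field; rewrite !gt_eqF.
have e4 : (4 : R) ^+ k = 2 ^+ k * 2 ^+ k.
  by rewrite -exprMn; congr (_ ^+ _); ring.
have -> : 4 * (m%:R * (e * dd + normc D * (dd * dd))) =
   eps * (8 * (L * L)) / M / 4 ^+ k
   + 4 * normc D * (L * L) / 2 ^+ k / 2 ^+ n.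
  rewrite /e /dd e4 e2n; field.
  by rewrite !gt_eqF.
have t1 : eps * (8 * (L * L)) / M <= eps / 2.
  rewrite ler_pdivrMr // /M; have := mulr_ge0 (ltW eps0) (mulr_ge0 L0 L0); nra.
have t2 : 4 * normc D * (L * L) / 2 ^+ k / 2 ^+ n <= eps / 2 / 4 ^+ k.
  have n2 : (n1%:R : R) <= 2 ^+ n.
    by rewrite -natrX ler_nat ltnW // (leq_ltn_trans n1n) // ltn_expl.
  have := lt_le_trans n1P n2; rewrite ltr_pdivrMr // => t.
  rewrite ler_pdivrMr // ler_pdivrMr // e4.
  have -> : eps / 2 / (2 ^+ k * 2 ^+ k) * 2 ^+ n * 2 ^+ k = eps / 2 * 2 ^+ n / 2 ^+ k.
    by field; rewrite gt_eqF.
  rewrite ler_pdivlMr //; lra.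
have -> : eps / 4 ^+ k = eps / 2 / 4 ^+ k + eps / 2 / 4 ^+ k.
  by field; rewrite gt_eqF // exprn_gt0.
apply: lerD => //.
by rewrite ler_pM2r // invr_gt0 exprn_gt0.
Qed.

Lemma goursat (eps : R) : 0 < eps -> exists n0, forall n, (n0 <= n)%N ->
  normc (box_sum zeta g n 0 0 (2 ^ n)) <= eps.
Proof.
move=> eps0; apply: contrapT => ng; apply: (not_bad_box eps0) => n0.
apply: contrapT => nn; apply: ng; exists n0 => n n0n.
rewrite leNgt; apply/negP => lt; apply: nn; exists n.
by rewrite expr0 divr1 !mul0n subn0.
Qed.

End GoursatTheorem.

(** * From the topology of [CC R] to real epsilons *)

Section ComplexTopology.
Variable R : realType.

(** Radii of balls in [CC R] are themselves elements of [R[i]]; a positive one is real, so it can be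
    traded for its real part. *)
Lemma nbhs_normcP (z : CC R) (A : set (CC R)) :
  nbhs z A <-> exists2 d : R, 0 < d & forall x, normc (x - z) < d -> A x.
Proof.
split.
  move=> /nbhs_ballP[e /= e0 eA].
  have eR : e = (complex.Re e)%:C%C by rewrite RRe_real // gtr0_real.
  exists (complex.Re e); first by move: e0; rewrite eR -[0](rmorph0 (real_complex R)) ltcR.
  move=> x xz; apply: eA; rewrite -ball_normE /=.
  by rewrite eR norm_normc ltcR normcB.
move=> [d d0 dA]; apply/nbhs_ballP; exists d%:C%C => /=.
  by rewrite -[0](rmorph0 (real_complex R)) ltcR.
move=> x; rewrite -ball_normE /= norm_normc ltcR normcB; exact: dA.
Qed.

Lemma derivable_cdiff (f : CC R -> CC R) (z : CC R) : derivable f z 1 ->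
  forall e : R, 0 < e -> exists2 d : R, 0 < d & forall x : R[i], normc (x - z) < d ->
    normc (f x - f z - 'D_1 f z * (x - z)) <= e * normc (x - z).
Proof.
move=> /derivable_nbhs /eqaddoP df e e0.
have /df : (0 : R[i]) < e%:C%C by rewrite -[0](rmorph0 (real_complex R)) ltcR.
move=> /nbhs_normcP[d d0 dP]; exists d => // x xz.
have := dP (x - z); rewrite subr0 => /(_ xz).
rewrite /= !norm_normc -rmorphM lecR /=.
congr (normc _ <= _).
rewrite -![(_ + _ : _ -> _) _]/(_ + _) -![(- _ : _ -> _) _]/(- _) /=.
by rewrite /cst [_ *: 1]mulr1 subrK opprD addrA [_ *: _]mulrC.
Qed.

Lemma continuous_normcP (f : CC R -> CC R) (z : CC R) : {for z, continuous f} ->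
  forall e : R, 0 < e -> exists2 d : R, 0 < d & forall x : R[i], normc (x - z) < d ->
    normc (f x - f z) < e.
Proof.
move=> cf e e0; have /cf/nbhs_normcP[d d0 dP] :
    nbhs (f z) [set y : CC R | normc (y - f z : R[i]) < e].
  by apply/nbhs_normcP; exists e.
by exists d.
Qed.

End ComplexTopology.

(** * Roots of unity of order [2^n] *)

Section Cis.
Variable R : realType.

(** The angle is counted in full turns, so that dyadic rationals give the roots of unity and
    [[0, 1]] closes up to the circle. *)
Definition cis (t : R) : R[i] := (cos (t * (pi *+ 2)) +i* sin (t * (pi *+ 2)))%C.

Lemma cisD s t : cis (s + t) = cis s * cis t.
Proof.
by rewrite /cis mulrDl cosD sinD; congr (_ +i* _)%C; rewrite addrC mulrC [X in _ + X]mulrC.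
Qed.

Lemma cis0 : cis 0 = 1.
Proof. by rewrite /cis mul0r cos0 sin0. Qed.

Lemma cis1 : cis 1 = 1.
Proof. by rewrite /cis mul1r cos2pi sin2pi. Qed.

Lemma cis_half : cis (1 / 2) = -1.
Proof.
rewrite /cis (_ : 1 / 2 * (pi *+ 2) = pi); last by rewrite -mulr_natr; field.
by rewrite cospi sinpi; apply/eqP; rewrite eq_complex /= oppr0 !eqxx.
Qed.

Lemma normc_cis t : normc (cis t) = 1.
Proof. by rewrite /= cos2Dsin2 sqrtr1. Qed.

Lemma cisX t n : cis (n%:R * t) = cis t ^+ n.
Proof.
elim: n => [|n IH]; first by rewrite mul0r cis0 expr0.
by rewrite -natr1 mulrDl mul1r cisD IH exprSr.
Qed.

Lemma cis_neq0 t : cis t != 0.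
Proof.
apply/eqP => e; have := normc_cis t.
by rewrite e normc0 => /eqP; rewrite eq_sym oner_eq0.
Qed.

Lemma lipschitz1_derive (f df : R -> R) :
  (forall x : R, is_derive x 1 f (df x)) -> (forall x, `|df x| <= 1) ->
  forall x y, `|f x - f y| <= `|x - y|.
Proof.
move=> fdf df1 x y; wlog xy : x y / x <= y => [H|].
  by have [/H//|/ltW/H] := leP x y; rewrite distrC [leRHS]distrC.
have [] := @MVT_segment R f df x y xy (fun z _ => fdf z).
  apply: derivable_within_continuous => z _; exact: ex_derive.
move=> c _ e; rewrite distrC e normrM distrC ler_piMl //.
Qed.

Lemma cis_lip s t : normc (cis s - cis t) <= 4 * pi * `|s - t|.
Proof.
apply: le_trans (ler_normc_ReIm _) _ => /=.
have E : `|s * (pi *+ 2) - t * (pi *+ 2)| = 2 * pi * `|s - t|.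
  have p0 : (0 : R) <= pi *+ 2 by rewrite mulrn_wge0 ?pi_ge0.
  by rewrite -mulrBl normrM (ger0_norm p0) mulrC -[pi *+ 2]mulr_natl.
have cs : `|cos (s * (pi *+ 2)) - cos (t * (pi *+ 2))| <= 2 * pi * `|s - t|.
  rewrite -E; apply: (@lipschitz1_derive cos (fun x => - sin x)) => x.
  by rewrite normrN sin_max.
have sn : `|sin (s * (pi *+ 2)) - sin (t * (pi *+ 2))| <= 2 * pi * `|s - t|.
  rewrite -E; apply: (@lipschitz1_derive sin cos) => x.
  exact: cos_max.
apply: le_trans (lerD cs sn) _; rewrite le_eqVlt; apply/orP; left; apply/eqP; ring.
Qed.

Definition root_unity (n k : nat) : R[i] := cis (k%:R / 2 ^+ n).

Lemma normc_root_unity n k : normc (root_unity n k) = 1.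
Proof. exact: normc_cis. Qed.

Lemma root_unity_neq0 n k : root_unity n k != 0.
Proof. exact: cis_neq0. Qed.

Lemma root_unityS n k : root_unity n k.+1 = root_unity n 1 * root_unity n k.
Proof. by rewrite /root_unity -cisD; congr cis; rewrite -mulrDl nat1r. Qed.

Lemma root_unityE n k : root_unity n k = root_unity n 1 ^+ k.
Proof. by rewrite /root_unity -cisX; congr cis; rewrite mul1r. Qed.

Lemma root_unity_order n k : root_unity n k ^+ (2 ^ n) = 1.
Proof.
rewrite /root_unity -cisX natrX mulrCA divff ?expf_neq0 // mulr1.
by rewrite -[k%:R]mulr1 cisX cis1 expr1n.
Qed.

(** If [cos x = 1] with [0 < x < 2 pi], the double angle formula gives [cos (x / 2) ^+ 2 = 1], hence
    [sin (x / 2) = 0], although [x / 2] lies strictly between [0] and [pi]. *)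
Lemma root_unity_pow n j : (0 < j < 2 ^ n)%N -> root_unity n 1 ^+ j != 1.
Proof.
move=> /andP[j0 jn]; rewrite -root_unityE; apply/eqP => -[].
set x := _ * (pi *+ 2) => cx _.
have p2 : (0 : R) < pi *+ 2 by rewrite mulrn_wgt0 ?pi_gt0.
have x0 : 0 < x by rewrite /x !mulr_gt0 ?ltr0n ?invr_gt0 ?exprn_gt0.
have x1 : x < pi *+ 2.
  rewrite /x -[ltRHS]mul1r ltr_pM2r //.
  by rewrite ltr_pdivrMr ?exprn_gt0 // mul1r -natrX ltr_nat.
have := cx; rewrite -[x](divfK (x := 2)) // mulr_natr cos_mulr2n => h.
have c2 : cos (x / 2) ^+ 2 = 1 by move: h; rewrite -mulr_natr; lra.
have : 0 < sin (x / 2).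
  apply: sin_gt0_pi; rewrite divr_gt0 //= ltr_pdivrMr //.
  by rewrite mulr_natr.
have := sin2cos2 (x / 2); rewrite c2 subrr => /eqP; rewrite sqrf_eq0 => /eqP ->.
by rewrite ltxx.
Qed.

End Cis.

(** * Means of the Cauchy kernel over roots of unity *)

Section KernelMean.
Variable R : realType.

Definition mean (n : nat) (F : R[i] -> R[i]) : R[i] :=
  (2 ^+ n)^-1 * \sum_(k < 2 ^ n) F (root_unity R n k).

Lemma eq_mean n F G : (forall w, normc w = 1 -> F w = G w) -> mean n F = mean n G.
Proof.
by move=> FG; congr (_ * _); apply: eq_bigr => k _; rewrite FG // normc_root_unity.
Qed.

Lemma meanD n F G : mean n (fun w => F w + G w) = mean n F + mean n G.
Proof. by rewrite /mean big_split mulrDr. Qed.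

Lemma meanZ n c F : mean n (fun w => c * F w) = c * mean n F.
Proof. by rewrite /mean -mulr_sumr mulrCA. Qed.

Lemma meanN n F : mean n (fun w => - F w) = - mean n F.
Proof. by rewrite /mean sumrN mulrN. Qed.

Lemma meanB n F G : mean n (fun w => F w - G w) = mean n F - mean n G.
Proof. by rewrite meanD meanN. Qed.

Lemma normc_pow2V n : normc ((2 ^+ n)^-1 : R[i]) = (2 ^+ n)^-1.
Proof.
have -> : (2 ^+ n)^-1 = ((2 ^+ n)^-1 : R)%:C%C :> R[i].
  by rewrite fmorphV rmorphXn rmorph_nat.
by rewrite normc_real ger0_norm // invr_ge0 exprn_ge0.
Qed.

Lemma normc_mean n F (e : R) : (forall w, normc w = 1 -> normc (F w) <= e) ->
  normc (mean n F) <= e.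
Proof.
move=> Fe; rewrite /mean normcM normc_pow2V mulrC ler_pdivrMr ?exprn_gt0 // mulrC -natrX.
apply: (@ler_normc_sum_ord _ _ (fun k => F (root_unity R n k))) => k _.
by rewrite Fe // normc_root_unity.
Qed.

Lemma neq_normc (w y : R[i]) : normc y < normc w -> w - y != 0.
Proof. by rewrite subr_eq0; apply: contraTneq => ->; rewrite ltxx. Qed.

Lemma sum_root_unityVX n j : (j < 2 ^ n)%N ->
  \sum_(k < 2 ^ n) (root_unity R n k)^-1 ^+ j = (if j == 0 then 2 ^+ n else 0)%N%:R :> R[i].
Proof.
move=> jn; case: eqP => [->|/eqP j0].
  under eq_bigr do rewrite expr0.
  by rewrite sumr_const card_ord.
set u := (root_unity R n 1)^-1 ^+ j.
have -> : \sum_(k < 2 ^ n) (root_unity R n k)^-1 ^+ j = \sum_(k < 2 ^ n) u ^+ k.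
  by apply: eq_bigr => k _; rewrite /u root_unityE -exprVn -!exprM mulnC.
have u1 : u != 1.
  rewrite /u exprVn invr_eq1; apply: root_unity_pow; rewrite jn andbT; lia.
have uN : u ^+ (2 ^ n) = 1.
  by rewrite /u -exprM mulnC exprM exprVn root_unity_order invr1 expr1n.
have := subrX1 u (2 ^ n); rewrite uN subrr => /esym/eqP.
by rewrite mulf_eq0 subr_eq0 (negbTE u1) /= => /eqP.
Qed.

(** Since [w ^+ (2 ^ n) = 1], the finite geometric sum of [y / w] is exactly
    [(1 - y ^+ (2 ^ n)) * (w / (w - y))]; averaging over [w] keeps only the term of exponent [0]. *)
Lemma mean_kernel n (y : R[i]) : normc y < 1 ->
  (1 - y ^+ (2 ^ n)) * mean n (fun w => w / (w - y)) = 1.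
Proof.
move=> y1; rewrite /mean mulrCA mulr_sumr.
have -> : \sum_(k < 2 ^ n) (1 - y ^+ (2 ^ n)) * (root_unity R n k / (root_unity R n k - y))
   = \sum_(k < 2 ^ n) \sum_(j < 2 ^ n) y ^+ j * (root_unity R n k)^-1 ^+ j.
  apply: eq_bigr => k _; set w := root_unity R n k.
  have w0 : w != 0 by exact: root_unity_neq0.
  have wy : w - y != 0 by rewrite neq_normc // normc_root_unity.
  under eq_bigr do rewrite -exprMn.
  have := subrX1 (y / w) (2 ^ n).
  rewrite exprMn exprVn root_unity_order invr1 mulr1.
  set S := \sum_(_ < _) _ => h.
  have -> : 1 - y ^+ (2 ^ n) = (w - y) / w * S.
    by rewrite -opprB h; field.
  by field; rewrite w0 wy.
rewrite exchange_big /=.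
have -> : \sum_(j < 2 ^ n) \sum_(k < 2 ^ n) y ^+ j * (root_unity R n k)^-1 ^+ j
    = \sum_(j < 2 ^ n) (if j == 0 :> nat then 2 ^+ n else 0).
  apply: eq_bigr => j _; rewrite -mulr_sumr sum_root_unityVX //.
  by case: eqP => [->|_]; rewrite ?mulr0 // expr0 mul1r natrX.
have e0 : (0 < 2 ^ n)%N by rewrite expn_gt0.
rewrite (bigD1 (Ordinal e0)) //= big1 ?addr0 ?mulVf ?expf_neq0 ?pnatr_eq0 // => j.
by rewrite -val_eqE /= => /negbTE ->.
Qed.

Lemma expr_pow2_small (q e : R) : 0 <= q < 1 -> 0 < e ->
  exists n0, forall n, (n0 <= n)%N -> q ^+ (2 ^ n) <= e.
Proof.
move=> /andP[q0 q1] e0.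
have : (fun n : nat => q ^+ n) @ \oo --> (0 : R) by apply: cvg_expr; rewrite ger0_norm.
move=> /cvgrPdist_le /(_ _ e0) [n0 _ h]; exists n0 => n nn0.
have := h (2 ^ n)%N; rewrite /= sub0r normrN ger0_norm ?exprn_ge0 //; apply.
by apply: (leq_trans nn0); rewrite ltnW // ltn_expl.
Qed.

Lemma mean_kernel_cvg (y : R[i]) (e : R) : normc y < 1 -> 0 < e ->
  exists n0, forall n, (n0 <= n)%N -> normc (mean n (fun w => w / (w - y)) - 1) <= e.
Proof.
move=> y1 e0.
(* With [q = y ^+ (2 ^ n)] the mean [M] satisfies [M - 1 = M * q]: the bound [1 / 2] on [q] yields
   [|M| <= 2], and then [e / 2] yields the claim. *)
pose e' := Num.min (1 / 2) (e / 2).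
have e'0 : 0 < e' by rewrite lt_min !divr_gt0.
have [||n0 h] := @expr_pow2_small (normc y) e'; rewrite ?normc_ge0 //.
exists n0 => n /h; rewrite le_min => /andP[h1 h2].
have yX m : normc (y ^+ m) = normc y ^+ m.
  by elim: m => [|m IH]; rewrite ?expr0 ?normc1 // !exprS normcM IH.
have := mean_kernel n y1; set M := mean _ _; rewrite -yX in h1 h2.
set q := y ^+ _ in h1 h2 * => hM.
have E : M - 1 = M * q by apply/eqP; rewrite -subr_eq0; apply/eqP; rewrite -{1}hM; ring.
have Mle : normc M <= 2.
  have : normc M - normc (M * q) <= 1.
    have := ler_normc_subD M (- (M * q)); rewrite normcN (_ : M - M * q = 1) ?normc1 //.
    by rewrite -hM; ring.
  have h3 : 0 <= 1 / 2 - normc q by rewrite subr_ge0.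
  have h4 := mulr_ge0 (normc_ge0 M) h3; rewrite [normc (M * q)]normcM => h5; lra.
rewrite E; apply: le_trans (ler_normcM Mle h2) _.
by rewrite mulrC divfK.
Qed.

(** Half of the [2 ^ n] equal chords already lead from [1] to [-1], a distance of [2]. *)
Lemma chord_lower n : (0 < n)%N -> 4 <= 2 ^+ n * normc (root_unity R n 1 - 1).
Proof.
case: n => // n _.
have h k : normc (root_unity R n.+1 k - 1) <= k%:R * normc (root_unity R n.+1 1 - 1).
  elim: k => [|k IH]; first by rewrite /root_unity mul0r cis0 subrr normc0 mul0r.
  have -> : root_unity R n.+1 k.+1 - 1 =
      root_unity R n.+1 k * (root_unity R n.+1 1 - 1) + (root_unity R n.+1 k - 1).
    by rewrite root_unityS; ring.
  rewrite -natr1 mulrDl mul1r [leRHS]addrC; apply: ler_normcD => //.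
  by rewrite normcM normc_root_unity mul1r.
have := h (2 ^ n)%N.
have -> : root_unity R n.+1 (2 ^ n) = -1.
  rewrite /root_unity -cis_half; congr cis; rewrite natrX exprS; field.
  by rewrite expf_neq0.
have -> : normc (-1 - 1 : R[i]) = 2.
  rewrite -opprD normcN; have := normc_real (2 : R); rewrite rmorph_nat ger0_norm //.
rewrite natrX exprS; lra.
Qed.

End KernelMean.

(** * Cauchy's formula *)

Section Cauchy.
Variable R : realType.

Lemma derivable_mulC (f g : CC R -> CC R) (x : CC R) :
  derivable f x 1 -> derivable g x 1 -> derivable (fun y => f y * g y : CC R) x 1.
Proof. by move=> df dg; exact: (@derivableM R[i] (CC R) f g x 1 df dg). Qed.

Lemma derivable_invC (f : CC R -> CC R) (x : CC R) :
  f x != 0 -> derivable f x 1 -> derivable (fun y => (f y)^-1 : CC R) x 1.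
Proof. by move=> f0 df; exact: (@derivableV R[i] (CC R) f x 1 f0 df). Qed.

Lemma derivable_subC (f g : CC R -> CC R) (x : CC R) :
  derivable f x 1 -> derivable g x 1 -> derivable (fun y => f y - g y : CC R) x 1.
Proof. by move=> df dg; exact: (@derivableB R[i] (CC R) (CC R) f g x 1 df dg). Qed.

Lemma derivable_idC (x : CC R) : derivable (fun y : CC R => y) x 1.
Proof. exact: (@derivable_id R[i] (CC R)). Qed.

Lemma derivable_cstC (c x : CC R) : derivable (fun=> c : CC R) x 1.
Proof. exact: (@derivable_cst R[i] (CC R) (CC R)). Qed.

Lemma derivable_kernel (f : CC R -> CC R) (z x : CC R) :
  derivable f x 1 -> x != z -> derivable (fun y : CC R => f y / (y - z) : CC R) x 1.
Proof.
move=> df xz.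
have dB := derivable_subC (@derivable_idC x) (@derivable_cstC z x).
have x0 : x - z != 0 by rewrite subr_eq0.
have dV := @derivable_invC (fun y => y - z) x x0 dB.
exact (derivable_mulC df dV).
Qed.

(* Cauchy's formula, obtained by contracting the circle of radius [r] towards [z]
   along [zeta s t]: the two horizontal sides of the parameter square cancel. *)
Lemma cauchy_mean (f : CC R -> CC R) (r : R) (z : R[i]) :
  normc z < r ->
  (forall x : R[i], normc x <= r -> x != z -> derivable f x 1) ->
  {for (z : CC R), continuous f} ->
  forall e : R, 0 < e -> exists n0, forall n, (n0 <= n)%N ->
    normc (mean n (fun w => f (r%:C%C * w) * (r%:C%C * w / (r%:C%C * w - z))) - f z) <= e.
Proof.
move=> zr df cf e e0.
have r0 : 0 < r by apply: le_lt_trans zr; exact: normc_ge0.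
have z0 := normc_ge0 z.
have rC0 : r%:C%C != 0 :> R[i] by rewrite fmorph_eq0 gt_eqF.
have nrw w : normc w = 1 -> normc (r%:C%C * w) = r.
  by move=> w1; rewrite normcM w1 mulr1 normc_real ger0_norm // ltW.
have rwz w : normc w = 1 -> r%:C%C * w - z != 0.
  by move=> w1; rewrite neq_normc // nrw.
(* A bound for the Cauchy kernel on the circle of radius [r]. *)
pose K := r / (r - normc z).
have K0 : 0 < K by rewrite divr_gt0 // subr_gt0.
have kerK w : normc w = 1 -> normc (r%:C%C * w / (r%:C%C * w - z)) <= K.
  move=> w1; rewrite normcM normcV nrw // ler_pM2l // lef_pV2 ?posrE ?subr_gt0 //.
    by have := ler_normc_subD (r%:C%C * w) (- z); rewrite normcN nrw.
  by rewrite lt_neqAle normc_ge0 andbT eq_sym; apply: contra_neq (rwz _ w1) => /eq0_normc.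
have e1 : 0 < e / (4 * K) by rewrite divr_gt0 // mulr_gt0.
have [d d0 dP] := continuous_normcP cf e1.
(* The contraction stops at the factor [ep]: positive, so that [z] is avoided, and small enough that
   the inner curve, whose points are at most [ep * (2 * r)] from [z], stays where [f] is close to
   [f z]. *)
pose ep := Num.min (1 / 2) (d / (2 * (2 * r))).
have ep0 : 0 < ep by rewrite lt_min !divr_gt0 // !mulr_gt0.
have ep1 : ep <= 1 / 2 by rewrite ge_min lexx.
have epd : ep * (2 * r) < d.
  apply: (@le_lt_trans _ _ (d / 2)); last by lra.
  rewrite -ler_pdivlMr ?mulr_gt0 //.
  have -> : d / 2 / (2 * r) = d / (2 * (2 * r)) by field; rewrite gt_eqF.
  by rewrite ge_min lexx orbT.
pose la (s : R) := ep + (1 - ep) * s.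
pose zeta (s t : R) : R[i] := z + (la s)%:C%C * (r%:C%C * cis t - z).
pose g (x : R[i]) : R[i] := f x / (x - z).
have laP s : 0 <= s <= 1 -> 0 < la s <= 1.
  by move=> /andP[s0 s1]; rewrite /la; apply/andP; split; nra.
have nrz t : normc (r%:C%C * cis t - z) <= 2 * r.
  have -> : 2 * r = r + r by ring.
  by apply: ler_normcB; rewrite ?nrw ?normc_cis // ltW.
have p0 := pi_gt0 R.
have [|s t s01 t01|n1 goursat1] := @goursat R zeta g (2 * r + r * (4 * pi)) _ _ e e0.
- move=> s t s' t' s01 t01 s01' t01'.
  have -> : zeta s t - zeta s' t' = (la s - la s')%:C%C * (r%:C%C * cis t - z)
     + (la s')%:C%C * (r%:C%C * (cis t - cis t')).
    by rewrite /zeta rmorphB /=; ring.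
  have h1 : normc ((la s - la s')%:C%C * (r%:C%C * cis t - z)) <= `|s - s'| * (2 * r).
    apply: ler_normcM => //; rewrite normc_real /la.
    have -> : ep + (1 - ep) * s - (ep + (1 - ep) * s') = (1 - ep) * (s - s') by ring.
    by rewrite normrM ger0_norm ?ler_piMl //; lra.
  have h2 : normc ((la s')%:C%C * (r%:C%C * (cis t - cis t'))) <= 1 * (r * (4 * pi * `|t - t'|)).
    apply: ler_normcM; last apply: ler_normcM.
    + by rewrite normc_real; have /andP[l0 l1] := laP _ s01'; rewrite ger0_norm // ltW.
    + by rewrite normc_real ger0_norm // ltW.
    + exact: cis_lip.
  apply: le_trans (ler_normcD h1 h2) _.
  have q1 : 0 <= r * `|t - t'| by rewrite mulr_ge0 // ltW.
  have q2 : 0 <= r * pi * `|s - s'| by rewrite !mulr_ge0 // ltW.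
  have -> : (2 * r + r * (4 * pi)) * (`|s - s'| + `|t - t'|) =
     `|s - s'| * (2 * r) + 1 * (r * (4 * pi * `|t - t'|)) +
       (2 * (r * `|t - t'|) + 4 * (r * pi * `|s - s'|)) by ring.
  by rewrite lerDl; lra.
- have /andP[l0 l1] := laP _ s01.
  have zz : zeta s t != z.
    rewrite -subr_eq0 /zeta addrAC subrr add0r mulf_neq0 ?rwz ?normc_cis //.
    by rewrite fmorph_eq0 gt_eqF.
  exists ('D_1 (g : CC R -> CC R) (zeta s t : CC R)).
  apply: derivable_cdiff; apply: derivable_kernel => //; apply: df => //.
  have -> : zeta s t = (1 - la s)%:C%C * z + (la s)%:C%C * (r%:C%C * cis t).
    by rewrite /zeta rmorphB rmorph1; ring.
  rewrite [leRHS](_ : r = (1 - la s) * r + la s * r); last by ring.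
  have l1' : 0 <= 1 - la s by rewrite subr_ge0.
  apply: ler_normcD; apply: ler_normcM.
  + by rewrite normc_real ger0_norm.
  + exact: ltW.
  + by rewrite normc_real ger0_norm // ltW.
  + by rewrite nrw // normc_cis.
have zr1 : normc (z / r%:C%C) < 1.
  by rewrite normcM normcV normc_real ger0_norm ?ltW // ltr_pdivrMr // mul1r.
(* The [+ 1] covers the case [f z = 0]. *)
have e2 : 0 < e / (4 * (normc (f z) + 1)).
  by rewrite divr_gt0 // mulr_gt0 // ltr_wpDl ?normc_ge0.
have [n2 ker2] := mean_kernel_cvg zr1 e2.
exists (n1 + n2 + 1)%N => n hn.
have [n1n n2n n0] : [/\ (n1 <= n)%N, (n2 <= n)%N & (0 < n)%N] by clear -hn; split; lia.
have := goursat1 n n1n.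
pose ker w : R[i] := r%:C%C * w / (r%:C%C * w - z).
pose inner w : R[i] := z + ep%:C%C * (r%:C%C * w - z).
(* On the inner curve the factor [ep] of the step cancels the one in the denominator of [g], so both
   curves carry the same kernel [ker] and the same prefactor. *)
have boxE : box_sum zeta g n 0 0 (2 ^ n) =
  (root_unity R n 1 - 1) * 2 ^+ n *
    mean n (fun w => f (r%:C%C * w) * ker w - f (inner w) * ker w).
  rewrite /box_sum.
  rewrite [X in X + _ - _ - _](_ : _ =
    path_sum g (fun k => grid zeta n (0 + k) (0 + 2 ^ n)) (2 ^ n)); last first.
    apply: eq_path_sum => k _; rewrite /grid /zeta !add0n natrX divff ?expf_neq0 //.
    by rewrite mul0r cis0 cis1.
  have E (a b c : R[i]) : a + b - a - c = b - c by ring.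
  rewrite E /mean mulrA mulfK ?expf_neq0 ?pnatr_eq0 // sumrB mulrBr /path_sum.
  congr (_ - _); rewrite mulr_sumr; apply: eq_bigr => k _; rewrite /grid !add0n.
    have zE j : zeta ((2 ^ n)%N%:R / 2 ^+ n) (j%:R / 2 ^+ n) = r%:C%C * root_unity R n j.
      rewrite /zeta natrX divff ?expf_neq0 // (_ : la 1 = 1); last by rewrite /la; ring.
      by rewrite rmorph1 mul1r addrC subrK.
    rewrite !zE root_unityS /g /ker; field.
    by rewrite rwz // normc_root_unity.
  have zE j : zeta (0%:R / 2 ^+ n) (j%:R / 2 ^+ n) = inner (root_unity R n j).
    by rewrite /zeta mul0r /la mulr0 addr0.
  rewrite !zE root_unityS /g /ker.
  have -> : inner (root_unity R n k) - z = ep%:C%C * (r%:C%C * root_unity R n k - z).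
    by rewrite /inner; ring.
  have -> : inner (root_unity R n 1 * root_unity R n k) - inner (root_unity R n k) =
    ep%:C%C * r%:C%C * ((root_unity R n 1 - 1) * root_unity R n k).
    by rewrite /inner; ring.
  field; rewrite rwz ?normc_root_unity //=.
  by rewrite fmorph_eq0 gt_eqF.
rewrite boxE normcM => h1.
set M1 := mean n _ in h1.
(* The prefactor [(root_unity R n 1 - 1) * 2 ^+ n] has modulus at least [4] by [chord_lower]. *)
have h1' : normc M1 <= e / 4.
  have := chord_lower R n0; move: h1.
  rewrite normcM [normc (2 ^+ n)](_ : _ = 2 ^+ n).
    rewrite [normc _ * 2 ^+ n]mulrC => h1 h4.
    rewrite ler_pdivlMr // mulrC; apply: le_trans h1.
    by rewrite ler_wpM2r ?normc_ge0.
  have := normc_real (2 ^+ n : R); rewrite rmorphXn rmorph_nat ger0_norm ?exprn_ge0 //.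
pose M2 := mean n (fun w => (f (inner w) - f z) * ker w).
have h2 : normc M2 <= e / 4.
  apply: normc_mean => w w1.
  have -> : e / 4 = e / (4 * K) * K by field; rewrite gt_eqF.
  apply: ler_normcM; last exact: kerK.
  apply/ltW/dP; rewrite /inner addrAC subrr add0r normcM normc_real ger0_norm ?(ltW ep0) //.
  apply: le_lt_trans epd; rewrite ler_pM2l //.
  have -> : 2 * r = r + r by ring.
  by apply: ler_normcB; rewrite ?nrw // ltW.
have h3 : normc (mean n ker - 1) <= e / (4 * (normc (f z) + 1)).
  have := ker2 n n2n; rewrite (@eq_mean _ _ _ ker) // => w w1.
  have wz := rwz _ w1; rewrite /ker; field.
  by rewrite wz rC0.
have -> : mean n (fun w => f (r%:C%C * w) * (r%:C%C * w / (r%:C%C * w - z))) - f z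
   = M1 + M2 + f z * (mean n ker - 1).
  rewrite /M1 /M2 mulrBr mulr1 addrA -meanZ -!meanD; congr (_ - _).
  by apply: eq_mean => w _; rewrite /ker; ring.
have h4 : normc (f z * (mean n ker - 1)) <= normc (f z) * (e / (4 * (normc (f z) + 1))).
  exact: ler_normcM.
apply: le_trans (ler_normcD (ler_normcD h1' h2) h4) _.
have fz := normc_ge0 (f z : R[i]).
have -> : normc (f z) * (e / (4 * (normc (f z) + 1))) =
   e / 4 * (normc (f z) / (normc (f z) + 1)) by field; lra.
have : normc (f z) / (normc (f z) + 1) <= 1 by rewrite ler_pdivrMr; lra.
move=> h5; have : e / 4 * (normc (f z) / (normc (f z) + 1)) <= e / 4.
  by rewrite ler_piMr // divr_ge0 // ltW.
lra.
Qed.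

End Cauchy.

(** * Herglotz transform and barycenter of the sampled real part *)

Section Herglotz.
Variable R : realType.
Local Notation "x ^*" := (conjc x) : complex_scope.

Lemma normc_conj (x : R[i]) : normc (x^*)%C = normc x.
Proof. by case: x => a b /=; rewrite sqrrN. Qed.

Lemma mean_conj n (F : R[i] -> R[i]) : mean n (fun w => (F w)^*%C) = ((mean n F)^*)%C.
Proof.
rewrite /mean rmorphM rmorph_sum /=; congr (_ * _).
by rewrite fmorphV rmorphXn rmorph_nat.
Qed.

Lemma conjc_circle (w : R[i]) : normc w = 1 -> (w^*)%C = w^-1.
Proof.
move=> w1; have := sqr_normc w; rewrite norm_normc w1 expr1n => e.
have w0 : w != 0 by apply/eqP => w0; move: w1; rewrite w0 normc0 => /eqP; rewrite eq_sym oner_eq0.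
by apply: (mulfI w0); rewrite -e divff.
Qed.

Lemma ReC_conj (x : R[i]) : (complex.Re x)%:C%C = (x + x^*%C) / 2 :> R[i].
Proof. exact: ReJ_add. Qed.

Variables (f : CC R -> CC R) (r : R).
Hypothesis f_diff : forall x : R[i], normc x <= r -> derivable f x 1.
Hypothesis r0 : 0 < r.

Let rC0 : r%:C%C != 0 :> R[i]. Proof. by rewrite fmorph_eq0 gt_eqF. Qed.
Let nrw w : normc w = 1 -> normc (r%:C%C * w) = r.
Proof. by move=> w1; rewrite normcM w1 mulr1 normc_real ger0_norm // ltW. Qed.
Let circle_neq0 (w : R[i]) : normc w = 1 -> w != 0.
Proof.
move=> w1; apply/eqP => w0; move: w1; rewrite w0 normc0 => /eqP.
by rewrite eq_sym oner_eq0.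
Qed.

Lemma derivable_continuousC (g : CC R -> CC R) (x : CC R) :
  derivable g x 1 -> {for x, continuous g}.
Proof. by move=> /derivable1_diffP; exact: differentiable_continuous. Qed.

(** At the center the Cauchy kernel is [1], and Cauchy's formula becomes the mean value property.
    Leaving out differentiability at [0] makes it applicable to a difference quotient at [0]. *)
Lemma cauchy_mean0 (g : CC R -> CC R) :
  (forall x : R[i], normc x <= r -> x != 0 -> derivable g x 1) ->
  {for (0 : CC R), continuous g} ->
  forall e : R, 0 < e -> exists n0, forall n, (n0 <= n)%N ->
    normc (mean n (fun w => g (r%:C%C * w)) - g 0) <= e.
Proof.
move=> dg cg e e0; have [|n0 h] := @cauchy_mean R g r 0 _ dg cg e e0.
  by rewrite normc0.
exists n0 => n /h; rewrite (@eq_mean _ _ _ (fun w => g (r%:C%C * w))) // => w w1.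
by rewrite subr0 divff ?mulr1 // mulf_neq0 // circle_neq0.
Qed.

(** Write the kernel as [2 w / (w - z) - 1] and [Re f] as half the sum of [f] and its conjugate. The
    part with [f] is Cauchy's formula and gives [f (r z)]. The part with the conjugate tends to the
    conjugate of [f 0], the [-1] contributes minus the real part of [f 0], and these two cancel
    because [f 0] is real. *)
Lemma herglotz_mean (z : R[i]) : normc z < 1 -> ((f 0)^*)%C = f 0 ->
  forall e : R, 0 < e -> exists n0, forall n, (n0 <= n)%N ->
    normc (mean n (fun w => (complex.Re (f (r%:C%C * w)))%:C%C * ((w + z) / (w - z)))
           - f (r%:C%C * z)) <= e.
Proof.
move=> z1 f0 e e0.
have zr : normc (r%:C%C * z) < r by rewrite normcM normc_real ger0_norm ?ltW // gtr_pMr.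
have e4 : 0 < e / 4 by rewrite divr_gt0.
have [|n1 h1] := @cauchy_mean R f r (r%:C%C * z) zr (fun x xr _ => f_diff xr) _ _ e4.
  by apply/derivable_continuousC/f_diff/ltW.
(* At [x = r w] the conjugate of [w / (w - z)] equals [r^2 / den x], which is holomorphic for
   [|x| <= r]; this turns the antiholomorphic part into the conjugate of a mean value at [0]. *)
pose den (x : CC R) : CC R := r%:C%C ^+ 2 - (r%:C%C * (z^*)%C) * x.
have den0 (x : R[i]) : normc x <= r -> den x != 0.
  move=> xr; rewrite /den neq_normc // expr2 !normcM normc_conj normc_real ger0_norm ?(ltW r0) //.
  rewrite -mulrA ltr_pM2l //; apply: le_lt_trans (ler_wpM2l (normc_ge0 z) xr) _.
  by rewrite gtr_pMl.
pose G (x : CC R) : CC R := f x * (den x)^-1.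
have dG (x : R[i]) : normc x <= r -> derivable G x 1.
  move=> xr.
  have dM := derivable_mulC (@derivable_cstC R (r%:C%C * (z^*)%C) x) (@derivable_idC R x).
  have dD := derivable_subC (@derivable_cstC R (r%:C%C ^+ 2) x) dM.
  exact (derivable_mulC (f_diff xr) (@derivable_invC R den x (den0 _ xr) dD)).
have r0' : normc (0 : R[i]) <= r by rewrite normc0 ltW.
have e4r : 0 < e / 4 / (r ^+ 2) by rewrite divr_gt0 // exprn_gt0.
have [n2 h2] := cauchy_mean0 (fun x xr _ => dG x xr) (derivable_continuousC (dG 0 r0')) e4r.
have [n3 h3] := cauchy_mean0 (fun x xr _ => f_diff xr) (derivable_continuousC (f_diff r0')) e4.
exists (n1 + n2 + n3)%N => n hn.
have {hn}[n1n n2n n3n] : [/\ (n1 <= n)%N, (n2 <= n)%N & (n3 <= n)%N].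
  by clear -hn; split; lia.
have {}h1 := h1 n n1n; have {}h2 := h2 n n2n; have {}h3 := h3 n n3n.
set M1 := mean n _ in h1; set M2 := mean n _ in h2; set M3 := mean n _ in h3.
have {}h2 : normc (r%:C%C ^+ 2 * M2 - f 0) <= e / 4.
  have -> : r%:C%C ^+ 2 * M2 - f 0 = r%:C%C ^+ 2 * (M2 - G 0).
    by rewrite /G /den; field.
  rewrite normcM -rmorphXn normc_real ger0_norm ?exprn_ge0 ?(ltW r0) //.
  by rewrite [leLHS]mulrC -ler_pdivlMr // exprn_gt0.
have -> : mean n (fun w => (complex.Re (f (r%:C%C * w)))%:C%C * ((w + z) / (w - z))) =
    M1 + ((r%:C%C ^+ 2 * M2)^*)%C - (M3 + (M3^*)%C) / 2.
  rewrite [_ / 2]mulrC /M1 /M2 /M3 -meanZ -!mean_conj -!meanD -meanZ -meanB.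
  apply: eq_mean => w w1.
  have w0 := circle_neq0 w1.
  have wz : w - z != 0 by rewrite neq_normc // w1.
  have E1 : r%:C%C * w / (r%:C%C * w - r%:C%C * z) = w / (w - z).
    by rewrite -mulrBr -mulf_div divff // mul1r.
  have E2 : r%:C%C ^+ 2 * G (r%:C%C * w) = f (r%:C%C * w) * (w / (w - z))^*%C.
    rewrite /G mulrCA; congr (_ * _); rewrite /den rmorphM fmorphV rmorphB /= (conjc_circle w1).
    have zw : 1 - (z^*)%C * w != 0.
      by rewrite neq_normc // normcM normc_conj w1 mulr1 normc1.
    have -> : r%:C%C ^+ 2 - r%:C%C * (z^*)%C * (r%:C%C * w) = r%:C%C ^+ 2 * (1 - (z^*)%C * w).
      by ring.
    have -> : w^-1 - (z^*)%C = w^-1 * (1 - (z^*)%C * w).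
      by rewrite mulrBr mulr1 mulrCA mulVf // mulr1.
    have E (a b : R[i]) : a != 0 -> a * (a * b)^-1 = b^-1.
      by move=> a0; rewrite invfM mulrA divff // mul1r.
    by rewrite !E ?invr_eq0 ?expf_neq0.
  rewrite E1 E2 ReC_conj rmorphM /= conjcK; field.
  by rewrite wz.
have fz : f (r%:C%C * z) = f (r%:C%C * z) + ((f 0)^*)%C - (f 0 + ((f 0)^*)%C) / 2.
  by rewrite f0; field.
rewrite fz.
have -> : M1 + ((r%:C%C ^+ 2 * M2)^*)%C - (M3 + (M3^*)%C) / 2 -
    (f (r%:C%C * z) + ((f 0)^*)%C - (f 0 + ((f 0)^*)%C) / 2) =
    (M1 - f (r%:C%C * z)) + ((r%:C%C ^+ 2 * M2 - f 0)^*)%C - 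
      ((M3 - f 0) + ((M3 - f 0)^*)%C) / 2.
  by rewrite !rmorphB; field.
have h2' : normc (r%:C%C ^+ 2 * M2 - f 0)^*%C <= e / 4 by rewrite normc_conj.
have h3' : normc (M3 - f 0)^*%C <= e / 4 by rewrite normc_conj.
have h4 : normc ((M3 - f 0 + (M3 - f 0)^*%C) / 2) <= (e / 4 + e / 4) * 1.
  apply: ler_normcM; first exact: ler_normcD.
  have := normc_real (2 : R); rewrite rmorph_nat ger0_norm // normcV => ->.
  by rewrite invf_le1 // ler1n.
apply: le_trans (ler_normcB (ler_normcD h1 h2') h4) _; lra.
Qed.

Lemma mean_root_unityV n : (0 < n)%N -> mean n (fun w : R[i] => w^-1) = 0.
Proof.
move=> n0; rewrite /mean.
have := @sum_root_unityVX R n 1; rewrite -{1}(expn0 2) ltn_exp2l // => /(_ n0) /= h.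
by rewrite [X in _ * X]h mulr0.
Qed.

(** Half of the mean comes from [f (r w) w], a mean of [x * f x], which vanishes at [0]. The other
    half is the conjugate of [f (r w) / w], that is, of [r] times the difference quotient of [f] at
    [0], whose mean tends to [f' 0], plus [f 0 / w], whose mean is [0]. *)
Lemma mean_barycenter : 'D_1 f 0 = 0 ->
  forall e : R, 0 < e -> exists n0, forall n, (n0 <= n)%N ->
    normc (mean n (fun w => (complex.Re (f (r%:C%C * w)))%:C%C * w)) <= e.
Proof.
move=> f'0 e e0.
have r0' : normc (0 : R[i]) <= r by rewrite normc0 ltW.
have d0 := f_diff r0'.
pose H (x : CC R) : CC R := x * f x.
have dH (x : R[i]) : normc x <= r -> derivable H x 1.
  by move=> xr; exact (derivable_mulC (@derivable_idC R x) (f_diff xr)).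
(* At [0] the junk value [x / 0 = 0] is the derivative of [f]. *)
pose Q (x : CC R) : CC R := (f x - f 0) / (x - 0).
have dQ (x : R[i]) : normc x <= r -> x != 0 -> derivable Q x 1.
  move=> xr x0.
  have dB := derivable_subC (f_diff xr) (@derivable_cstC R (f 0) x).
  exact (@derivable_kernel R (fun y => f y - f 0) 0 x dB x0).
have Q0 : Q 0 = 0 by rewrite /Q subrr mul0r.
have cQ : {for (0 : CC R), continuous Q}.
  move=> A; rewrite Q0 => /nbhs_normcP[d d_gt0 dA]; apply/nbhs_normcP.
  have d2 : 0 < d / 2 by rewrite divr_gt0.
  have [d' d'0 h] := derivable_cdiff d0 d2; exists d' => // x xd; apply: dA.
  have := h x xd; rewrite f'0 mul0r !subr0 /Q subr0 normcM normcV => {}h.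
  have [->|x0] := eqVneq x 0; first by rewrite normc0 invr0 mulr0.
  have nx : 0 < normc x.
    by rewrite lt_neqAle normc_ge0 andbT eq_sym; apply: contra_neq x0 => /eq0_normc.
  by rewrite ltr_pdivrMr // (le_lt_trans h) // ltr_pM2r //; lra.
have er : 0 < e * r by rewrite mulr_gt0.
have er' : 0 < e / r by rewrite divr_gt0.
have [n1 h1] := cauchy_mean0 (fun x xr _ => dH x xr) (derivable_continuousC (dH 0 r0')) er.
have [n2 h2] := cauchy_mean0 dQ cQ er'.
exists (n1 + n2 + 1)%N => n hn.
have {hn}[n1n n2n n0] : [/\ (n1 <= n)%N, (n2 <= n)%N & (0 < n)%N].
  by clear -hn; split; lia.
have := h1 n n1n; have := h2 n n2n; rewrite Q0 /H mul0r !subr0.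
set M2 := mean n _; set M1 := mean n _ => {}h2 {}h1.
have -> : mean n (fun w => (complex.Re (f (r%:C%C * w)))%:C%C * w) =
    (r%:C%C^-1 * M1 + ((r%:C%C * M2 + f 0 * mean n (fun w => w^-1))^*)%C) / 2.
  rewrite [_ / 2]mulrC /M1 /M2 -!meanZ -meanD -mean_conj -meanD -meanZ.
  apply: eq_mean => w w1; have w0 := circle_neq0 w1.
  rewrite ReC_conj.
  have -> : r%:C%C * Q (r%:C%C * w) + f 0 * w^-1 = f (r%:C%C * w) * w^-1.
    by rewrite /Q subr0; field; rewrite rC0 w0.
  rewrite -(conjc_circle w1) rmorphM /= conjcK; field.
  by rewrite rC0.
rewrite mean_root_unityV // mulr0 addr0.
have t1 : normc (r%:C%C^-1 * M1) <= e.
  by rewrite normcM normcV normc_real (ger0_norm (ltW r0)) [leLHS]mulrC ler_pdivrMr.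
have t2 : normc ((r%:C%C * M2)^*)%C <= e.
  rewrite normc_conj normcM normc_real ger0_norm ?(ltW r0) //.
  by rewrite [leLHS]mulrC -ler_pdivlMr.
have t3 : normc (2^-1 : R[i]) <= 2^-1.
  by rewrite normcV; have := normc_real (2 : R); rewrite rmorph_nat ger0_norm // => ->.
apply: le_trans (ler_normcM (ler_normcD t1 t2) t3) _; lra.
Qed.

End Herglotz.

(** * Centered measures with at most three atoms *)

Section Triples.
Variable R : realType.

(* [(x, y, l)] encodes the measure [\sum_i l_i \delta_(x_i + i y_i)]. *)
Definition triple : Type := ('rV[R]_3 * 'rV[R]_3 * 'rV[R]_3)%type.

Definition vertex (v : triple) (j : 'I_3) : R[i] := (v.1.1 ord0 j +i* v.1.2 ord0 j)%C.

Definition weight (v : triple) (j : 'I_3) : R := v.2 ord0 j.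

(** Only closed conditions: weights may vanish and points may coincide, which makes the set
    compact. *)
Definition centered_triple : set triple := [set v : triple |
  [/\ forall j, v.1.1 ord0 j ^+ 2 + v.1.2 ord0 j ^+ 2 = 1,
      forall j, 0 <= weight v j,
      \sum_j weight v j = 1,
      \sum_j weight v j * v.1.1 ord0 j = 0 &
      \sum_j weight v j * v.1.2 ord0 j = 0]].

Definition ctriple : Type := set_type centered_triple.

Definition ctriple_eval (v : triple) (g : R[i] -> R) : R :=
  \sum_j weight v j * g (vertex v j).

Definition decomposable (I : finType) (w : I -> R[i]) (p : I -> R) :=
  exists s : seq ({nonneg R} * ctriple), forall g : R[i] -> R,
    \sum_i p i * g (w i) = \sum_(c <- s) c.1%:num * ctriple_eval (set_val c.2) g.

Definition scale_atom (c : {nonneg R}) (x : {nonneg R} * ctriple) : {nonneg R} * ctriple :=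
  ((c%:num * x.1%:num)%:nng, x.2).

End Triples.

(** * Reduction of a centered measure to at most three atoms *)

Section Decomposition.
Variables (R : realType) (I : finType) (w : I -> R[i]).
Hypothesis w_circle : forall i, normc (w i) = 1.
Implicit Types p v : I -> R.

Definition supp p : {set I} := finset (fun i => p i != 0).

Lemma in_supp p i : (i \in supp p) = (p i != 0).
Proof. by rewrite /supp inE. Qed.

Definition centered p := \sum_i p i * complex.Re (w i) = 0 /\ \sum_i p i * complex.Im (w i) = 0.

Lemma w_sqr i : complex.Re (w i) ^+ 2 + complex.Im (w i) ^+ 2 = 1.
Proof.
have := w_circle i; case: (w i) => a b /= h.
by rewrite -[LHS]sqr_sqrtr ?h ?expr1n // addr_ge0 ?sqr_ge0.
Qed.

Lemma decomposable_conic p p1 p2 (c1 c2 : R) : 0 <= c1 -> 0 <= c2 ->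
  (forall i, p i = c1 * p1 i + c2 * p2 i) ->
  decomposable w p1 -> decomposable w p2 -> decomposable w p.
Proof.
move=> c10 c20 pE [s1 h1] [s2 h2].
exists (map (scale_atom (NngNum c10)) s1 ++ map (scale_atom (NngNum c20)) s2) => g.
under eq_bigr do rewrite pE mulrDl -!mulrA.
rewrite big_split -!mulr_sumr h1 h2 big_cat !big_map !mulr_sumr /=.
by congr (_ + _); apply: eq_bigr => i _; rewrite mulrA.
Qed.

Lemma sum_enum_pad (S : {set I}) (i0 : I) (F : I -> R) : (#|S| <= 3)%N ->
  \sum_(j < 3) (if (j < #|S|)%N then F (nth i0 (enum S) j) else 0) = \sum_(i in S) F i.
Proof.
move=> S3; rewrite -[RHS]big_enum /= [RHS](big_nth i0) [RHS]big_mkord -cardE.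
rewrite (big_ord_widen_cond 3 xpredT (fun j => F (nth i0 (enum S) j))) //=.
by rewrite [RHS]big_mkcond.
Qed.

Lemma decomposable_small p : (#|supp p| <= 3)%N ->
  (forall i, 0 <= p i) -> centered p -> decomposable w p.
Proof.
set S := supp p => S3 p0 [pRe pIm].
have sumS (F : I -> R) : \sum_i p i * F i = \sum_(i in S) p i * F i.
  rewrite [RHS]big_mkcond; apply: eq_bigr => i _.
  by rewrite in_supp; case: eqP => //= ->; rewrite mul0r.
have [S0|/set0Pn[i0 i0S]] := eqVneq S finset.set0.
  by exists [::] => g; rewrite sumS S0 big_set0 big_nil.
pose t := \sum_i p i.
have t0 : 0 < t.
  rewrite /t (bigD1 i0) //= ltr_pwDl ?sumr_ge0 // lt_neqAle p0 andbT eq_sym.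
  by move: i0S; rewrite in_supp.
(* Slots beyond the support fall back on [i0], so their points still lie on the circle; [q] gives
   them weight [0]. *)
pose e (j : 'I_3) := nth i0 (enum S) j.
pose q (j : 'I_3) := if (j < #|S|)%N then p (e j) / t else 0.
have qsum (F : I -> R) : \sum_j q j * F (e j) = t^-1 * \sum_i p i * F i.
  rewrite sumS mulr_sumr -(@sum_enum_pad S i0 (fun i => t^-1 * (p i * F i))) //.
  apply: eq_bigr => j _; rewrite /q /e; case: ifP => _; last by rewrite mul0r.
  by rewrite mulrAC mulrC.
pose v : triple R := (\row_j complex.Re (w (e j)), \row_j complex.Im (w (e j)), \row_j q j).
have vwt j : weight v j = q j by rewrite /weight mxE.
have vK : centered_triple v.
  split => [j|j|||]; rewrite /= ?mxE.
  - exact: w_sqr.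
  - by rewrite vwt /q; case: ifP => // _; rewrite divr_ge0 // ltW.
  - transitivity (\sum_j q j * (fun _ => 1) (e j)).
      by apply: eq_bigr => j _; rewrite vwt mulr1.
    rewrite (qsum (fun=> 1)) (eq_bigr p) => [|i _]; last by rewrite mulr1.
    by rewrite mulVf // gt_eqF.
  - transitivity (\sum_j q j * (fun i => complex.Re (w i)) (e j)).
      by apply: eq_bigr => j _; rewrite vwt mxE.
    by rewrite (qsum (fun i => complex.Re (w i))) pRe mulr0.
  - transitivity (\sum_j q j * (fun i => complex.Im (w i)) (e j)).
      by apply: eq_bigr => j _; rewrite vwt mxE.
    by rewrite (qsum (fun i => complex.Im (w i))) pIm mulr0.
exists [:: (NngNum (ltW t0), exist _ v (mem_set vK))] => g.
rewrite big_seq1 /= /ctriple_eval.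
transitivity (t * \sum_j q j * (fun i => g (w i)) (e j)).
  by rewrite (qsum (fun i => g (w i))) mulrA divff ?mul1r // gt_eqF.
congr (_ * _); apply: eq_bigr => j _; rewrite vwt; congr (_ * g _).
by rewrite /vertex /= !mxE; case: (w (e j)).
Qed.

(* Moving along a direction in the kernel of the three linear constraints until a
   weight vanishes. *)
Lemma support_reduction p v i0 : (forall i, 0 <= p i) -> (forall i, p i = 0 -> v i = 0) ->
  v i0 < 0 -> exists2 t : R, 0 < t & (forall i, 0 <= p i + t * v i) /\
    (#|supp (fun i => p i + t * v i)%R| < #|supp p|)%N.
Proof.
move=> p0 pv vi0.
(* The ratio test of the simplex method: the weight at [i1] is the first to reach [0], and at that
   time the others are still nonnegative. *)
pose i1 := [arg min_(i < i0 | v i < 0) (p i / - v i)]%O.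
have [v1 min1] : v i1 < 0 /\ forall j, v j < 0 -> p i1 / - v i1 <= p j / - v j.
  by rewrite /i1; case: arg_minP => // i vi mi.
have p1 : 0 < p i1.
  rewrite lt_neqAle p0 andbT eq_sym; apply: contraTneq v1 => /pv ->.
  by rewrite ltxx.
exists (p i1 / - v i1); first by rewrite divr_gt0 // oppr_gt0.
split => [i|].
  have [vi|vi] := ltP (v i) 0; last by rewrite addr_ge0 // mulr_ge0 // divr_ge0 ?oppr_ge0 // ltW.
  have := min1 _ vi; rewrite ler_pdivlMr ?oppr_gt0 // mulrN => h.
  by rewrite -[X in _ + X]opprK subr_ge0.
apply: proper_card; apply/properP; split.
  apply/fintype.subsetP => i; rewrite !in_supp; apply: contraNneq => pi0.
  by rewrite (pv _ pi0) pi0 mulr0 addr0 ?eqxx.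
exists i1; rewrite in_supp; first by rewrite gt_eqF.
by rewrite negbK; apply/eqP; field; rewrite lt_eqF.
Qed.

(** A matrix with more than three rows and three columns, here [1], [Re w] and [Im w], has a nonzero
    left kernel. *)
Lemma constraint_kernel (S : {set I}) : (3 < #|S|)%N -> exists v : I -> R,
  [/\ forall i, i \notin S -> v i = 0, exists i, v i != 0,
      \sum_i v i = 0 & centered v].
Proof.
move=> S3.
pose F (k : 'I_3) (i : I) : R := nth 0 [:: 1; complex.Re (w i); complex.Im (w i)] k.
pose A : 'M[R]_(#|S|, 3) := \matrix_(j, k) F k (enum_val j).
have : kermx A != 0.
  rewrite kermx_eq0 /row_free; apply: contraTneq S3 => rA.
  by rewrite -leqNgt -rA rank_leq_col.
move=> /rowV0Pn[u /sub_kermxP uA u0].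
pose v i := \sum_(j < #|S|) if enum_val j == i then u ord0 j else 0.
have vsum G : \sum_i v i * G i = \sum_j u ord0 j * G (enum_val j).
  under eq_bigr do rewrite mulr_suml.
  rewrite exchange_big /=; apply: eq_bigr => j _.
  rewrite (bigD1 (enum_val j)) //= eqxx big1 ?addr0 // => i /negbTE.
  by rewrite eq_sym => ->; rewrite mul0r.
have con k : \sum_i v i * F k i = 0.
  rewrite vsum; have := congr1 (fun M : 'rV[R]_3 => M ord0 k) uA.
  rewrite !mxE => h; rewrite -[RHS]h.
  by apply: eq_bigr => j _; rewrite mxE.
exists v; split.
- move=> i iS; rewrite /v big1 // => j _; case: eqP => // e.
  by move: iS; rewrite -e enum_valP.
- have [j uj] : exists j, u ord0 j != 0.
    apply: contrapT => nu; move/eqP: u0; apply; apply/rowP => j; rewrite mxE.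
    by apply/eqP; apply: contrapT => /negP h; apply: nu; exists j.
  exists (enum_val j); rewrite /v (bigD1 j) //= eqxx big1 ?addr0 // => k kj.
  by case: eqP => // /enum_val_inj e; rewrite e eqxx in kj.
- rewrite -[RHS](con ord0); apply: eq_bigr => i _; by rewrite mulr1.
- by split; [rewrite -[RHS](con (lift ord0 ord0)) | rewrite -[RHS](con ord_max)].
Qed.

Lemma decomposition p : (forall i, 0 <= p i) -> centered p -> decomposable w p.
Proof.
have [m] := ubnP #|supp p|; elim: m p => // m IH p; rewrite ltnS => Sm p0 pc.
have [S3|S3] := leqP #|supp p| 3; first exact: decomposable_small.
have [v [vS [i vi] v0 [vRe vIm]]] := constraint_kernel S3.
have pv j : p j = 0 -> v j = 0 by move=> pj; apply: vS; rewrite in_supp pj eqxx.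
(* A nonzero direction of sum [0] has entries of both signs, so an atom disappears whichever way one
   moves. *)
have signs (u : I -> R) : \sum_i u i = 0 -> (exists i, u i != 0) -> exists i, u i < 0.
  move=> us [k uk]; apply: contrapT => nu.
  have upos j : 0 <= u j by rewrite leNgt; apply/negP => h; apply: nu; exists j.
  have := psumr_eq0P (fun j _ => upos j) us => /(_ k isT) e.
  by rewrite e eqxx in uk.
have [i1 vi1] := signs v v0 (ex_intro _ i vi).
have [i2 vi2] : exists i, (- v i) < 0.
  apply: signs; first by rewrite sumrN v0 oppr0.
  by exists i; rewrite oppr_eq0.
have [t1 t10 [q1 c1]] := support_reduction p0 pv vi1.
have pv' j : p j = 0 -> - v j = 0 by move=> /pv ->; rewrite oppr0.
have [t2 t20 [q2 c2]] := support_reduction p0 pv' vi2.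
have cen (t : R) (u : I -> R) : centered u -> centered (fun i => p i + t * u i).
  move=> [uRe uIm]; case: pc => pRe pIm; split.
    under eq_bigr do rewrite mulrDl -mulrA.
    by rewrite big_split -mulr_sumr /= uRe pRe mulr0 addr0.
  under eq_bigr do rewrite mulrDl -mulrA.
  by rewrite big_split -mulr_sumr /= uIm pIm mulr0 addr0.
have d1 := IH _ (leq_trans c1 Sm) q1 (cen _ _ (conj vRe vIm)).
have vN : centered (fun i => - v i).
  by split; under eq_bigr do rewrite mulNr; rewrite sumrN ?vRe ?vIm oppr0.
have d2 := IH _ (leq_trans c2 Sm) q2 (cen _ _ vN).
have t12 : 0 < t1 + t2 by rewrite addr_gt0.
(* With these weights the displacements [t1 * v] and [- t2 * v] cancel. *)
apply: (@decomposable_conic _ _ _ (t2 / (t1 + t2)) (t1 / (t1 + t2)) _ _ _ d1 d2).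
- by rewrite divr_ge0 ?ltW.
- by rewrite divr_ge0 ?ltW.
- by move=> j; field; rewrite gt_eqF.
Qed.

End Decomposition.

(** * Triples as elements of [Theta] *)

Section ToTheta.
Variable R : realType.

Definition atoms (w1 w2 w3 : CC R) (l1 l2 l3 : R) : functional R :=
  fun g => l1%:C%C * g w1 + l2%:C%C * g w2 + l3%:C%C * g w3.

Lemma circleE (w : CC R) : (w \in circle R) = (normc (w : R[i]) == 1).
Proof.
apply/idP/eqP; rewrite inE /circle /= norm_normc.
  by move=> h; apply: complexI; rewrite h.
by move=> ->.
Qed.

(** Taking moduli in [l a = - m b] gives [l = m = 1 / 2], and then [b = - a]. *)
Lemma two_atoms_kind1 (a b : CC R) (l m : R) (L : functional R) :
  normc (a : R[i]) = 1 -> normc (b : R[i]) = 1 -> 0 <= l -> 0 <= m -> l + m = 1 ->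
  l%:C%C * a + m%:C%C * b = 0 ->
  (forall g, L g = l%:C%C * g a + m%:C%C * g b) -> theta_kind1 L.
Proof.
move=> a1 b1 l0 m0 lm /eqP lamb LE; rewrite addr_eq0 in lamb; move/eqP in lamb.
have lm' : l = m.
  have := congr1 (fun x : R[i] => normc x) lamb.
  by rewrite normcN !normcM a1 b1 !mulr1 !normc_real !ger0_norm.
have l2 : l = 2^-1 by rewrite -lm' in lm; lra.
have m2 : m = 2^-1 by rewrite -lm'.
have C2 : (2^-1 : R)%:C%C = 2^-1 :> R[i] by rewrite fmorphV rmorph_nat.
have ba : b = - a.
  have h2 : (2^-1 : R[i]) != 0 by rewrite invr_neq0 // pnatr_eq0.
  by move: lamb; rewrite l2 m2 C2 -mulrN => /(mulfI h2) ->; rewrite opprK.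
exists a; split; first by rewrite circleE a1.
by apply/funext => g; rewrite LE l2 m2 C2 ba -mulrDr mulrC.
Qed.

(** A coincidence of points or a zero weight leaves at most two atoms, hence the first kind; in the
    remaining case the points are distinct and the weights positive, hence the second. *)
Lemma atoms_in_Theta (w1 w2 w3 : CC R) (l1 l2 l3 : R) :
  normc (w1 : R[i]) = 1 -> normc (w2 : R[i]) = 1 -> normc (w3 : R[i]) = 1 ->
  0 <= l1 -> 0 <= l2 -> 0 <= l3 -> barycentric w1 w2 w3 0 l1 l2 l3 ->
  in_Theta (atoms w1 w2 w3 l1 l2 l3).
Proof.
move=> n1 n2 n3 p1 p2 p3 [ls bar].
have C0 : 0%:C%C = 0 :> R[i] by [].
have [e|w12] := eqVneq w1 w2.
  left; apply: (@two_atoms_kind1 w1 w3 (l1 + l2) l3) => //; first exact: addr_ge0.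
    by rewrite -[RHS]bar e rmorphD mulrDl.
  by move=> g; rewrite /atoms e rmorphD mulrDl.
have [e|w13] := eqVneq w1 w3.
  left; apply: (@two_atoms_kind1 w1 w2 (l1 + l3) l2) => //; first exact: addr_ge0.
  - by rewrite addrAC.
  - by rewrite -[RHS]bar e rmorphD mulrDl addrAC.
  - by move=> g; rewrite /atoms e rmorphD mulrDl addrAC.
have [e|w23] := eqVneq w2 w3.
  left; apply: (@two_atoms_kind1 w1 w2 l1 (l2 + l3)) => //; first exact: addr_ge0.
  - by rewrite addrA.
  - by rewrite -[RHS]bar e rmorphD mulrDl addrA.
  - by move=> g; rewrite /atoms e rmorphD mulrDl addrA.
have [e|l10] := eqVneq l1 0.
  left; apply: (@two_atoms_kind1 w2 w3 l2 l3) => //.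
  - by rewrite -ls e add0r.
  - by rewrite -[RHS]bar e C0 mul0r add0r.
  - by move=> g; rewrite /atoms e C0 mul0r add0r.
have [e|l20] := eqVneq l2 0.
  left; apply: (@two_atoms_kind1 w1 w3 l1 l3) => //.
  - by rewrite -ls e addr0.
  - by rewrite -[RHS]bar e C0 mul0r addr0.
  - by move=> g; rewrite /atoms e C0 mul0r addr0.
have [e|l30] := eqVneq l3 0.
  left; apply: (@two_atoms_kind1 w1 w2 l1 l2) => //.
  - by rewrite -ls e addr0.
  - by rewrite -[RHS]bar e C0 mul0r addr0.
  - by move=> g; rewrite /atoms e C0 mul0r addr0.
right; exists w1, w2, w3, l1, l2, l3; split; first by rewrite !circleE n1 n2 n3 eqxx.
split; first by split.
split; first by split.
split; last by [].
by split; rewrite lt_neqAle eq_sym ?l10 ?l20 ?l30 ?p1 ?p2 ?p3.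
Qed.

Lemma atoms_proj (w1 w2 w3 : CC R) (l1 l2 l3 : R) (g : CC R -> CC R) :
  complex.Re (atoms w1 w2 w3 l1 l2 l3 g) =
    l1 * complex.Re (g w1) + l2 * complex.Re (g w2) + l3 * complex.Re (g w3) /\
  complex.Im (atoms w1 w2 w3 l1 l2 l3 g) =
    l1 * complex.Im (g w1) + l2 * complex.Im (g w2) + l3 * complex.Im (g w3).
Proof.
rewrite /atoms; case: (g w1) => a1 b1; case: (g w2) => a2 b2; case: (g w3) => a3 b3 /=.
by rewrite !mul0r !subr0 !addr0.
Qed.

Lemma theta_atoms (t : Theta R) : exists w1 w2 w3 l1 l2 l3,
  theta_fun t = atoms w1 w2 w3 l1 l2 l3.
Proof.
case: t => L /= [[a [_ ->]]|[w1 [w2 [w3 [l1 [l2 [l3 [_ [_ [_ [_ ->]]]]]]]]]]]; last first.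
  by exists w1, w2, w3, l1, l2, l3.
(* The padding atom sits at the origin, off the circle, with weight [0]: only the form of the
   functional is asserted. *)
exists a, (- a), 0, 2^-1, 2^-1, 0; apply/funext => g; rewrite /atoms.
by rewrite fmorphV rmorph_nat rmorph0 mul0r addr0 -mulrDr mulrC.
Qed.

Lemma theta_Re (t : Theta R) (g : CC R -> CC R) :
  complex.Re (theta_fun t g) = theta_eval (fun w => complex.Re (g w)) t.
Proof.
rewrite /theta_eval; have [w1 [w2 [w3 [l1 [l2 [l3 ->]]]]]] := theta_atoms t.
by rewrite !(atoms_proj _ _ _ _ _ _ _).1.
Qed.

Lemma theta_Im (t : Theta R) (g : CC R -> CC R) :
  complex.Im (theta_fun t g) = theta_eval (fun w => complex.Im (g w)) t.
Proof.
rewrite /theta_eval; have [w1 [w2 [w3 [l1 [l2 [l3 ->]]]]]] := theta_atoms t.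
by rewrite (atoms_proj _ _ _ _ _ _ _).2 (atoms_proj _ _ _ _ _ _ _).1.
Qed.

Definition ctriple_functional (v : triple R) : functional R :=
  atoms (vertex v ord0) (vertex v (lift ord0 ord0)) (vertex v (lift ord0 (lift ord0 ord0)))
        (weight v ord0) (weight v (lift ord0 ord0)) (weight v (lift ord0 (lift ord0 ord0))).

Lemma ctriple_in_Theta (v : ctriple R) : in_Theta (ctriple_functional (set_val v)).
Proof.
have [vc vp vs vx vy] := set_valP v.
have nv j : normc (vertex (set_val v) j) = 1 by rewrite /= vc sqrtr1.
apply: atoms_in_Theta => //; split.
  by rewrite -[RHS]vs !big_ord_recl big_ord0 addr0 addrA.
move: vx vy; rewrite !big_ord_recl !big_ord0 /weight /vertex => vx vy.
apply/eqP; rewrite eq_complex /=; apply/andP; split; apply/eqP.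
  by rewrite -[RHS]vx; ring.
by rewrite -[RHS]vy; ring.
Qed.

Definition to_Theta (v : ctriple R) : Theta R := exist _ _ (ctriple_in_Theta v).

Lemma to_ThetaE (v : ctriple R) (g : CC R -> R) :
  theta_eval g (to_Theta v) = ctriple_eval (set_val v) g.
Proof.
rewrite /theta_eval /theta_fun /to_Theta /sval /ctriple_functional.
rewrite (atoms_proj _ _ _ _ _ _ _).1 /ctriple_eval.
by rewrite !big_ord_recl big_ord0 addr0 addrA.
Qed.

End ToTheta.

Section CircleContinuity.
Variable R : realType.

Lemma circle_normc (w : R[i]) : circle R w <-> normc w = 1.
Proof.
rewrite /circle /= norm_normc; split => [h|->] //.
by apply: complexI; rewrite h.
Qed.

Lemma continuous_circleP (g : CC R -> R) :
  {within circle R, continuous g} <->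
  forall w : R[i], normc w = 1 -> forall e : R, 0 < e -> exists2 d : R, 0 < d &
    forall x : R[i], normc x = 1 -> normc (x - w) < d -> `|g w - g x| < e.
Proof.
rewrite subspace_continuousP; split.
  move=> cg w w1 e e0; have /circle_normc w1' := w1.
  have /cvgrPdist_lt/(_ e e0)/nbhs_normcP[d d0 dP] := cg w w1'.
  by exists d => // x x1 xw; apply: dP => //; apply/circle_normc.
move=> cg w w1; apply/cvgrPdist_lt => e e0.
have /circle_normc w1' := w1.
have [d d0 dP] := cg w w1' e e0; apply/nbhs_normcP; exists d => // x xw x1.
by apply: dP => //; apply/circle_normc.
Qed.

End CircleContinuity.

Lemma cvg_rsum (R : realType) (T J : Type) (F : set_system T) {FF : Filter F}
    (s : seq J) (f : J -> T -> R) (l : J -> R) : (forall j, f j @ F --> l j) ->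
  (fun x => \sum_(j <- s) f j x) @ F --> \sum_(j <- s) l j.
Proof.
move=> fl; elim: s => [|j s IH].
  by rewrite big_nil; under eq_fun do rewrite big_nil; exact: cvg_cst.
by rewrite big_cons; under eq_fun do rewrite big_cons; exact: cvgD.
Qed.

(** * Compactness of the space of centered triples *)

Section TripleTopology.
Variable R : realType.

HB.instance Definition _ := PseudoMetric.on (ctriple R).

(** The antipodal pair [1], [-1] with equal weights; the third slot repeats [-1] with weight [0]. *)
Definition triple0 : triple R :=
  (\row_j (if j == ord0 then 1 else -1), 0, \row_j (if j == ord_max then 0 else 2^-1)).

Lemma triple0_centered : centered_triple triple0.
Proof.
split => [j|j|||]; rewrite /weight /= ?mxE.
- by case: ifP; rewrite ?sqrrN expr1n expr0n addr0.
- by case: ifP => // _; rewrite invr_ge0.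
- by rewrite !big_ord_recl big_ord0 !mxE /=; lra.
- by rewrite !big_ord_recl big_ord0 !mxE /=; lra.
- by rewrite big1 // => j _; rewrite !mxE mulr0.
Qed.

HB.instance Definition _ := isPointed.Build (ctriple R)
  (exist _ triple0 (mem_set triple0_centered) : set_type (@centered_triple R)).

Lemma continuous_x j : continuous (fun v : triple R => v.1.1 ord0 j).
Proof.
move=> v; apply: (@continuous_comp _ _ _ (fun v : triple R => v.1.1) (fun M => M ord0 j)).
  by apply: (@continuous_comp _ _ _ fst fst); exact: cvg_fst.
exact: coord_continuous.
Qed.

Lemma continuous_y j : continuous (fun v : triple R => v.1.2 ord0 j).
Proof.
move=> v; apply: (@continuous_comp _ _ _ (fun v : triple R => v.1.2) (fun M => M ord0 j)).
  by apply: (@continuous_comp _ _ _ fst snd); [exact: cvg_fst | exact: cvg_snd].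
exact: coord_continuous.
Qed.

Lemma continuous_weight j : continuous (fun v : triple R => weight v j).
Proof.
move=> v; apply: (@continuous_comp _ _ _ (fun v : triple R => v.2) (fun M => M ord0 j)).
  exact: cvg_snd.
exact: coord_continuous.
Qed.

Lemma closed_level (f : triple R -> R) (c : R) : continuous f -> closed [set v | f v = c].
Proof. by move=> /continuous_closedP cf; apply: (cf [set x | x = c]); exact: closed_eq. Qed.

Lemma centered_triple_closed : closed (@centered_triple R).
Proof.
have -> : @centered_triple R =
  (\bigcap_(j in setT) [set v : triple R | v.1.1 ord0 j ^+ 2 + v.1.2 ord0 j ^+ 2 = 1]) `&`
  (\bigcap_(j in setT) [set v : triple R | 0 <= weight v j]) `&`
  [set v : triple R | \sum_j weight v j = 1] `&`
  [set v : triple R | \sum_j weight v j * v.1.1 ord0 j = 0] `&`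
  [set v : triple R | \sum_j weight v j * v.1.2 ord0 j = 0].
  apply/seteqP; split => v.
    by move=> [h1 h2 h3 h4 h5]; split => //; split => //; split => //; split => // j _ /=.
  by move=> [[[[h1 h2] h3] h4] h5]; split => // j; [exact: h1 | exact: h2].
have cM (f g : triple R -> R) : continuous f -> continuous g -> continuous (fun v => f v * g v).
  by move=> cf cg v; apply: cvgM; [exact: cf | exact: cg].
have cS (F : 'I_3 -> triple R -> R) : (forall j, continuous (F j)) ->
    continuous (fun v => \sum_j F j v).
  by move=> cF v; apply: cvg_rsum => j; exact: cF.
repeat apply: closedI.
- apply: closed_bigI => j _; apply: closed_level => v.
  apply: cvgD; first exact: (cM _ _ (@continuous_x j) (@continuous_x j)).
  exact: (cM _ _ (@continuous_y j) (@continuous_y j)).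
- apply: closed_bigI => j _; have /continuous_closedP cw := @continuous_weight j.
  by apply: (cw [set x | 0 <= x]); exact: closed_ge.
- by apply: closed_level; apply: cS => j; exact: continuous_weight.
- apply: closed_level; apply: cS => j.
  exact: cM (@continuous_weight j) (@continuous_x j).
- apply: closed_level; apply: cS => j.
  exact: cM (@continuous_weight j) (@continuous_y j).
Qed.

Lemma centered_triple_compact : compact (@centered_triple R).
Proof.
pose B : set 'rV[R]_3 := [set v | forall j, `[-1, 1]%classic (v ord0 j)].
have cB : compact B.
  by apply: (@rV_compact R 3 (fun _ => `[-1, 1]%classic)) => j; exact: segment_compact.
have cBBB := compact_setX (compact_setX cB cB) cB.
apply: subclosed_compact cBBB _; first exact: centered_triple_closed.
move=> v [h1 h2 h3 _ _].
have sq (a b : R) : a ^+ 2 + b ^+ 2 = 1 -> -1 <= a <= 1 by move=> h; apply/andP; split; nra.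
split; [split|] => j; rewrite /= in_itv /=.
- exact: sq (h1 j).
- by apply: (@sq _ (v.1.1 ord0 j)); rewrite addrC h1.
- apply/andP; split; first by apply: le_trans (h2 j); lra.
  by rewrite -h3 (bigD1 j) //= lerDl sumr_ge0.
Qed.

Lemma ctriple_nbhs (v : ctriple R) (A : set (ctriple R)) : nbhs v A ->
  exists U : set (triple R), [/\ open U, U (set_val v) & set_val @^-1` U `<=` A].
Proof.
by case=> B /= [[U oU UB] Bv BA]; exists U; rewrite -UB in Bv BA.
Qed.

(** Compactness of the subset becomes compactness of the subtype: a filter is pushed to the ambient
    space, where its cluster point lies in the subset. *)
Lemma ctriple_compact : compact [set: ctriple R].
Proof.
move=> F PF _.
pose G : set_system (triple R) := fmap set_val F.
have GK : G (@centered_triple R).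
  have FT : F setT by exact: filterT.
  by apply: (@filterS _ F _ _ (set_val @^-1` @centered_triple R) _ FT) => v _; exact: set_valP.
have [p [Kp clp]] := @centered_triple_compact G _ GK.
exists (exist _ p (mem_set Kp)); split => // A B FA /ctriple_nbhs[U [oU Up UB]].
have GA : G (set_val @` A).
  by rewrite /G /fmap /=; move: FA; apply: (@filterS _ F) => a Aa; exists a.
have [_ [[a Aa <-] Ua]] := clp _ _ GA (open_nbhs_nbhs (conj oU Up)).
by exists a; split => //; exact: UB.
Qed.

Lemma ctriple_hausdorff : hausdorff_space (ctriple R).
Proof.
move=> p q clpq; apply: val_inj.
apply: (@norm_hausdorff R (triple R)) => A B.
rewrite !nbhsE => -[A' [oA Ap AA]] [B' [oB Bq BB]].
have cv : continuous (set_val : ctriple R -> triple R) by exact: initial_continuous.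
have [| |x [xA xB]] := clpq (set_val @^-1` A') (set_val @^-1` B').
- by apply: cv; exact: open_nbhs_nbhs.
- by apply: cv; exact: open_nbhs_nbhs.
by exists (set_val x); split; [exact: AA | exact: BB].
Qed.

(** Continuity of [g] along the circle is enough because the vertices of a centered triple never
    leave it. *)
Lemma ctriple_eval_continuous (g : CC R -> R) : {within circle R, continuous g} ->
  continuous (fun v : ctriple R => ctriple_eval (set_val v) g).
Proof.
move=> /continuous_circleP cg.
have cv : continuous (set_val : ctriple R -> triple R) by exact: initial_continuous.
have cvc (h : triple R -> R) : continuous h -> continuous (fun u : ctriple R => h (set_val u)).
  by move=> ch u A nA; exact (cv u (h @^-1` A) (ch (set_val u) A nA)).
move=> v; rewrite /ctriple_eval; have FN : Filter (nbhs v) := nbhs_filter v.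
apply: (@cvg_rsum R (ctriple R) _ (nbhs v) FN) => j.
apply: cvgM; first exact: (cvc _ (@continuous_weight j) v).
apply/cvgrPdist_lt => e e0.
have circ (u : ctriple R) : normc (vertex (set_val u) j) = 1.
  by have [h _ _ _ _] := set_valP u; rewrite /= h sqrtr1.
have [d d0 dP] := cg _ (circ v) e e0.
have d2 : 0 < d / 2 by rewrite divr_gt0.
have /cvgrPdist_lt/(_ _ d2) cx := cvc _ (@continuous_x j) v.
have /cvgrPdist_lt/(_ _ d2) cy := cvc _ (@continuous_y j) v.
near=> u; apply: dP; first exact: circ.
apply: le_lt_trans (ler_normc_ReIm _) _ => /=.
have hx : `|(set_val v).1.1 ord0 j - (set_val u).1.1 ord0 j| < d / 2 by near: u.
have hy : `|(set_val v).1.2 ord0 j - (set_val u).1.2 ord0 j| < d / 2 by near: u.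
rewrite distrC in hx; rewrite distrC in hy; lra.
Unshelve. all: by end_near. Qed.

End TripleTopology.

(** * Positive functionals on the Cantor space *)

Section Cylinders.

Definition agree (n : nat) (x y : cantor_space) := forall k, (k < n)%N -> x k = y k.

Lemma agree_refl n x : agree n x x. Proof. by []. Qed.

Lemma agree_sym n x y : agree n x y -> agree n y x.
Proof. by move=> xy k kn; rewrite xy. Qed.

Lemma agree_trans n x y z : agree n x y -> agree n y z -> agree n x z.
Proof. by move=> xy yz k kn; rewrite xy // yz. Qed.

Lemma agreeW m n x y : (m <= n)%N -> agree n x y -> agree m x y.
Proof. by move=> mn xy k km; apply: xy; exact: leq_trans km mn. Qed.

(** Sets depending on finitely many coordinates; they are both open and closed. *)
Definition cylinder : set (set cantor_space) :=
  [set A | exists n, forall x y, agree n x y -> A x -> A y].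

Lemma cylinder0 : cylinder set0.
Proof. by exists 0%N. Qed.

Lemma cylinderU : setU_closed cylinder.
Proof.
move=> A B [n hA] [m hB]; exists (n + m)%N => x y xy [Ax|Bx].
  by left; apply: hA Ax; apply: agreeW xy; rewrite leq_addr.
by right; apply: hB Bx; apply: agreeW xy; rewrite leq_addl.
Qed.

Lemma cylinderC : setC_closed cylinder.
Proof.
by move=> A [n hA]; exists n => x y xy nAx Ay; apply: nAx; apply: hA Ay; exact: agree_sym.
Qed.

Lemma agree_nbhs n (x : cantor_space) : nbhs x [set y | agree n x y].
Proof.
elim: n => [|n IH]; first by apply: filterS filterT.
have hn : nbhs x [set y : cantor_space | y n = x n].
  have := @proj_continuous nat (fun=> bool) n x [set b | b = x n]; apply.
  exact: discrete_set1.
apply: filterS (filterI IH hn) => y [xy yn] k.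
by rewrite ltnS leq_eqVlt => /orP[/eqP ->|/xy].
Qed.

Lemma cylinder_open A : cylinder A -> open A.
Proof.
move=> [n hA]; rewrite openE => x Ax.
by apply: filterS (agree_nbhs n x) => y xy; exact: hA xy Ax.
Qed.

Lemma cylinder_closed A : cylinder A -> closed A.
Proof. by move=> /cylinderC/cylinder_open/open_closedC; rewrite setCK. Qed.

Lemma cantor_closed_compact (A : set cantor_space) : closed A -> compact A.
Proof. by move=> cA; apply: subclosed_compact cA cantor_space_compact _. Qed.

Lemma compact_nat_cover (A : set cantor_space) (U : nat -> set cantor_space) :
  closed A -> (forall n, open (U n)) -> A `<=` \bigcup_n U n ->
  exists N, A `<=` \bigcup_(n < N) U n.
Proof.
move=> /cantor_closed_compact; rewrite compact_cover => cA oU AU.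
have [D _ AD] := cA nat setT U (fun n _ => oU n) AU.
exists (\max_(i <- finmap.enum_fset D) i).+1 => x /AD[n /= nD Ux].
by exists n => //=; rewrite ltnS; apply: (@leq_bigmax_seq _ _ xpredT id).
Qed.

(** The complement of [U] is compact and covered by the increasing open sets of points that differ
    from [x] before [n], so one of them contains it. *)
Lemma open_agree (U : set cantor_space) (x : cantor_space) : open U -> U x ->
  exists n, [set y | agree n x y] `<=` U.
Proof.
move=> oU Ux.
have cyl n : cylinder [set y | ~ agree n x y].
  by exists n => y z yz nxy xz; apply: nxy; apply: agree_trans xz (agree_sym yz).
have [| | |N h] := @compact_nat_cover (~` U) (fun n => [set y | ~ agree n x y]).
- by rewrite closedC.
- by move=> n; exact/cylinder_open.
- move=> y nUy; apply: contrapT => h; apply: nUy.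
  suff -> : y = x by [].
  apply/funext => k; apply: contrapT => yk; apply: h; exists k.+1 => // xy.
  by apply: yk; rewrite xy.
exists N => y xy; apply: contrapT => /h[n /= nN]; apply.
by apply: agreeW xy; exact: ltnW.
Qed.

Lemma open_bigcup_cylinder (U : set cantor_space) : open U ->
  exists A : nat -> set cantor_space, (forall n, cylinder (A n)) /\ U = \bigcup_n A n.
Proof.
move=> oU; exists (fun n => [set x | [set y | agree n x y] `<=` U]); split.
  by move=> n; exists n => x y xy xU z yz; apply: xU; exact: agree_trans xy yz.
apply/seteqP; split => x; first by move=> /(open_agree oU)[n]; exists n.
by move=> [n _]; apply; exact: agree_refl.
Qed.

(** The points around which [G] oscillates by less than [e] on the cylinder of depth [n] form an
    open set; by compactness finitely many depths suffice, and their maximum serves everywhere. *)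
Lemma cantor_uniform (R : realType) (G : cantor_space -> R) (e : R) : continuous G -> 0 < e ->
  exists n, forall x y, agree n x y -> `|G x - G y| < e.
Proof.
move=> cG e0.
pose A n := [set x : cantor_space | forall y z, agree n x y -> agree n x z -> `|G y - G z| < e].
have cyl n : cylinder (A n).
  exists n => x y xy Ax u v yu yv.
  by apply: Ax; exact: agree_trans xy _.
have [| | |N h] := @compact_nat_cover setT A.
- exact: closedT.
- by move=> n; exact/cylinder_open.
- move=> x _.
  pose U : set cantor_space := G @^-1` (ball (G x) (e / 2)).
  have oU : open U by apply: open_comp => [y _|]; [exact: cG | exact: ball_open].
  have Ux : U x by apply: ballxx; rewrite divr_gt0.
  have [n hn] := open_agree oU Ux; exists n => // y z /hn + /hn.
  rewrite /U /= -ball_normE /= => hy hz.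
  have -> : G y - G z = (G x - G z) - (G x - G y) by ring.
  by apply: le_lt_trans (ler_normB _ _) _; lra.
exists N => x y xy; have [n /= nN] := h x Logic.I; apply; first exact: agree_refl.
by apply: agreeW xy; exact: ltnW.
Qed.

End Cylinders.

Definition cylinder_display : measure_display. Proof. exact. Qed.

(** Two copies of the Cantor space: this one carries the algebra of cylinders, [cantor_borel] the
    sigma-algebra generated by it. *)
Definition cylinder_space : Type := cantor_space.

HB.instance Definition _ := Pointed.on cylinder_space.
HB.instance Definition _ := @isAlgebraOfSets.Build cylinder_display cylinder_space
  cylinder cylinder0 cylinderU cylinderC.

Definition cantor_borel : Type := g_sigma_algebraType (@measurable _ cylinder_space).

HB.instance Definition _ := Measurable.on cantor_borel.

Lemma cylinder_measurable (A : set cantor_space) :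
  cylinder A -> measurable (A : set cantor_borel).
Proof. by move=> cA; apply: sub_sigma_algebra. Qed.

Lemma cantor_open_measurable (U : set cantor_space) :
  open U -> measurable (U : set cantor_borel).
Proof.
move=> /open_bigcup_cylinder[A [cA ->]]; apply: bigcup_measurable => n _.
exact: cylinder_measurable.
Qed.

Lemma measurable_fun_gt d (T : measurableType d) (R : realType) (f : T -> R) :
  (forall a, measurable [set x | a < f x]) -> measurable_fun [set: T] f.
Proof.
move=> mf; apply: (measurability _ (RGenOInfty.measurableE R)) => _ [_ [a ->] <-].
rewrite setTI; apply: (eq_ind _ measurable (mf a)); apply/seteqP.
by split => x /=; rewrite in_itv /= andbT.
Qed.

Lemma cantor_continuous_measurable (R : realType) (G : cantor_space -> R) :
  continuous G -> measurable_fun [set: cantor_borel] (G : cantor_borel -> R).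
Proof.
move=> cG; apply: measurable_fun_gt => a; apply: cantor_open_measurable.
by apply: (@open_comp _ _ G [set y | a < y]) => [x _|]; [exact: cG | exact: open_gt].
Qed.

(** * The measure of a positive functional on bounded functions *)

Section Riesz.
Variables (R : realType) (L : (cantor_space -> R) -> R).

Definition bounded_on (T : Type) (F : T -> R) := exists M, forall x, `|F x| <= M.

Hypothesis L_add : forall F G, bounded_on F -> bounded_on G ->
  L (fun x => F x + G x) = L F + L G.
Hypothesis L_scale : forall (c : R) F, bounded_on F -> L (fun x => c * F x) = c * L F.
Hypothesis L_ge0 : forall F, bounded_on F -> (forall x, 0 <= F x) -> 0 <= L F.

Lemma bounded_indic (A : set cantor_space) : bounded_on (\1_A : cantor_space -> R).
Proof. by exists 1 => x; rewrite indicE; case: (_ \in _); rewrite ?normr1 ?normr0. Qed.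

Lemma bounded_cst (c : R) : bounded_on (fun _ : cantor_space => c).
Proof. by exists `|c|. Qed.

Lemma bounded_add (F G : cantor_space -> R) :
  bounded_on F -> bounded_on G -> bounded_on (fun x => F x + G x).
Proof.
move=> [M hM] [N hN]; exists (M + N) => x.
exact: le_trans (ler_normD _ _) (lerD (hM x) (hN x)).
Qed.

Lemma bounded_scale c (F : cantor_space -> R) :
  bounded_on F -> bounded_on (fun x => c * F x).
Proof. by move=> [M hM]; exists (`|c| * M) => x; rewrite normrM ler_wpM2l. Qed.

Lemma bounded_sum (I : Type) (s : seq I) (F : I -> cantor_space -> R) :
  (forall i, bounded_on (F i)) -> bounded_on (fun x => \sum_(i <- s) F i x).
Proof.
move=> bF; elim: s => [|i s IH].
  by under eq_fun do rewrite big_nil; exact: bounded_cst.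
by under eq_fun do rewrite big_cons; exact: bounded_add.
Qed.

Lemma L0 : L (fun=> 0) = 0.
Proof.
rewrite -[RHS](mul0r (L (fun=> 0))) -L_scale; last exact: bounded_cst.
by congr L; apply/funext => x; rewrite mulr0.
Qed.

Lemma L_sum (I : Type) (s : seq I) (F : I -> cantor_space -> R) :
  (forall i, bounded_on (F i)) ->
  L (fun x => \sum_(i <- s) F i x) = \sum_(i <- s) L (F i).
Proof.
move=> bF; elim: s => [|i s IH].
  by under eq_fun do rewrite big_nil; rewrite big_nil L0.
under eq_fun do rewrite big_cons.
by rewrite big_cons L_add ?IH //; exact: bounded_sum.
Qed.

Lemma L_le F G : bounded_on F -> bounded_on G -> (forall x, F x <= G x) -> L F <= L G.
Proof.
move=> bF bG FG; rewrite -subr_ge0.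
have bN := bounded_scale (-1) bF.
rewrite -mulN1r -L_scale // -L_add //; apply: L_ge0; first exact: bounded_add.
by move=> x; rewrite mulN1r subr_ge0.
Qed.

Lemma L_dist F G e : bounded_on F -> bounded_on G -> (forall x, `|F x - G x| <= e) ->
  `|L F - L G| <= e * L (fun=> 1).
Proof.
move=> bF bG FG.
have b1 := bounded_scale e (bounded_cst 1).
have h1 : L F <= L G + e * L (fun=> 1).
  rewrite -L_scale -?L_add //; last exact: bounded_cst.
  apply: L_le => //; first exact: bounded_add.
  by move=> x; have := FG x; rewrite ler_norml => /andP[_]; rewrite mulr1; lra.
have h2 : L G <= L F + e * L (fun=> 1).
  rewrite -L_scale -?L_add //; last exact: bounded_cst.
  apply: L_le => //; first exact: bounded_add.
  by move=> x; have := FG x; rewrite ler_norml => /andP[+ _]; rewrite mulr1; lra.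
by rewrite ler_norml; apply/andP; split; lra.
Qed.

(** [L] applies to indicators directly, and those of cylinders are continuous, so the approximation
    of indicators in the usual Riesz theorem does not arise. *)
Definition cyl_measure (A : set cylinder_space) : \bar R := (L \1_A)%:E.

Lemma cyl_measure0 : cyl_measure set0 = 0%E.
Proof. by rewrite /cyl_measure indic0 L0. Qed.

Lemma cyl_measure_ge0 A : (0 <= cyl_measure A)%E.
Proof.
by rewrite lee_fin; apply: L_ge0 => [|x]; [exact: bounded_indic | rewrite indicE].
Qed.

(* By compactness a cylinder is never a disjoint union of infinitely many nonempty ones. *)
Lemma cyl_measure_sigma_additive : semi_sigma_additive cyl_measure.
Proof.
move=> F mF tF mUF.
have [| | |N h] := @compact_nat_cover (\bigcup_n F n) F.
- exact: cylinder_closed.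
- by move=> n; exact/cylinder_open/mF.
- by [].
apply: cvg_near_cst; exists N => // n /= Nn.
rewrite /cyl_measure sumEFin -L_sum; last by move=> i; exact: bounded_indic.
congr (L _)%:E; apply/funext => x.
have [[k _ Fkx]|nUx] := pselect ((\bigcup_n F n) x); last first.
  rewrite big1 ?indicE ?memNset // => i _; rewrite indicE memNset // => Fix.
  by apply: nUx; exists i.
have [j /= jN Fjx] := h x (ex_intro2 _ _ k Logic.I Fkx).
rewrite big_mkord (bigD1 (Ordinal (leq_trans jN Nn))) //= big1 => [|i ij].
  by rewrite !indicE !mem_set ?addr0 //; exists j.
rewrite indicE memNset // => Fix.
have := tF i j Logic.I Logic.I (ex_intro _ x (conj Fix Fjx)).
by move=> e; rewrite -val_eqE /= e eqxx in ij.
Qed.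

HB.instance Definition _ := isMeasure.Build _ _ _ cyl_measure
  cyl_measure0 cyl_measure_ge0 cyl_measure_sigma_additive.

Definition riesz_measure : {measure set cantor_borel -> \bar R} :=
  measure_extension cyl_measure.

Lemma riesz_measureE A : cylinder A -> riesz_measure A = (L \1_A)%:E.
Proof. by move=> cA; rewrite /riesz_measure /= /measure_extension measurable_mu_extE. Qed.

Lemma riesz_measureT : riesz_measure setT = (L (fun=> 1))%:E.
Proof.
rewrite riesz_measureE; last by exists 0%N.
by congr (L _)%:E; apply/funext => x; rewrite indicE in_setT.
Qed.

Definition extend_word n (b : {ffun 'I_n -> bool}) : cantor_space :=
  fun k => if insub k is Some i then b i else false.

Definition word_cylinder n (b : {ffun 'I_n -> bool}) : set cantor_space :=
  [set x | agree n (extend_word b) x].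

Lemma word_cylinder_cylinder n (b : {ffun 'I_n -> bool}) : cylinder (word_cylinder b).
Proof. by exists n => x y xy bx; exact: agree_trans bx xy. Qed.

(** [G] sampled at the first [n] bits of [x], continued by [false]; a finite combination of
    indicators of cylinders, on which [L] and the integral agree. *)
Definition step_fun (G : cantor_space -> R) n (x : cantor_space) : R :=
  \sum_(b : {ffun 'I_n -> bool}) G (extend_word b) * \1_(word_cylinder b) x.

Lemma step_funE G n x : exists2 b : {ffun 'I_n -> bool},
  word_cylinder b x & step_fun G n x = G (extend_word b).
Proof.
pose b := [ffun i : 'I_n => x i].
have bx : word_cylinder b x.
  by move=> k kn; rewrite /extend_word insubT /= ffunE.
exists b => //; rewrite /step_fun (bigD1 b) //= big1 => [|c cb].
  by rewrite indicE mem_set // mulr1 addr0.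
rewrite indicE memNset ?mulr0 // => cx; move/eqP: cb; apply.
apply/ffunP => i; rewrite ffunE -(cx i) //.
by rewrite /extend_word valK.
Qed.

Lemma riesz_integrable G : bounded_on G ->
  measurable_fun [set: cantor_borel] (G : cantor_borel -> R) ->
  riesz_measure.-integrable setT (EFin \o (G : cantor_borel -> R)).
Proof.
move=> [M hM] mG; apply: measurable_bounded_integrable => //.
  by rewrite riesz_measureT ltry.
exists M; split; first exact: num_real.
by move=> y My x _; apply: le_trans (hM x) (ltW My).
Qed.

Lemma measurable_indic_cylinder A : cylinder A ->
  measurable_fun [set: cantor_borel] (\1_A : cantor_borel -> R).
Proof. by move=> cA; apply: measurable_indic; exact: cylinder_measurable. Qed.

Lemma step_fun_measurable G n :
  measurable_fun [set: cantor_borel] (step_fun G n : cantor_borel -> R).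
Proof.
apply: measurable_sum => b; apply: measurable_funM; first exact: measurable_cst.
apply: measurable_indic_cylinder; exact: word_cylinder_cylinder.
Qed.

Lemma step_fun_bounded G n : bounded_on (step_fun G n).
Proof. by apply: bounded_sum => b; apply: bounded_scale; exact: bounded_indic. Qed.

Lemma riesz_step_fun G n :
  (\int[riesz_measure]_x (step_fun G n x)%:E)%E = (L (step_fun G n))%:E.
Proof.
rewrite /step_fun L_sum; last by move=> b; apply: bounded_scale; exact: bounded_indic.
under eq_integral do rewrite -sumEFin.
have int_indic (b : {ffun 'I_n -> bool}) : riesz_measure.-integrable setT
    (fun x => (\1_(word_cylinder b) x)%:E).
  apply: riesz_integrable; first exact: bounded_indic.
  apply: measurable_indic_cylinder; exact: word_cylinder_cylinder.
rewrite integral_sum //; last first.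
  move=> b; under eq_fun do rewrite EFinM.
  exact: integrableZl.
rewrite -sumEFin; apply: eq_bigr => b _.
under eq_integral do rewrite EFinM.
rewrite integralZl // integral_indic //; last first.
  apply: cylinder_measurable; exact: word_cylinder_cylinder.
rewrite setIT riesz_measureE; last exact: word_cylinder_cylinder.
by rewrite -EFinM L_scale //; exact: bounded_indic.
Qed.

(** By uniform continuity some step function is within [e] of [G]; the integral and [L] agree on it
    and each moves by at most [e * L 1]. *)
Lemma riesz_continuous G : continuous G ->
  riesz_measure.-integrable setT (EFin \o (G : cantor_borel -> R)) /\
  (\int[riesz_measure]_x (G x)%:E)%E = (L G)%:E.
Proof.
move=> cG.
have mG := cantor_continuous_measurable cG.
have near_step e : 0 < e -> exists n, forall x, `|G x - step_fun G n x| <= e.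
  move=> e0; have [n hn] := cantor_uniform cG e0; exists n => x.
  have [b bx ->] := step_funE G n x; apply/ltW/hn; exact: agree_sym.
have bG : bounded_on G.
  have [n hn] := near_step 1 ltr01; have [M hM] := step_fun_bounded G n.
  exists (1 + M) => x; rewrite -[G x](subrK (step_fun G n x)).
  exact: le_trans (ler_normD _ _) (lerD (hn x) (hM x)).
have iG := riesz_integrable bG mG; split => //.
have fG : (\int[riesz_measure]_x (G x)%:E)%E \is a fin_num by exact: integrable_fin_num iG.
rewrite -(fineK fG); congr (_%:E).
have C0 : 0 <= L (fun=> 1) by apply: L_ge0 => //; exact: bounded_cst.
have key e : 0 < e -> `|fine (\int[riesz_measure]_x (G x)%:E) - L G| <= 2 * e * L (fun=> 1).
  move=> e0; have [n hn] := near_step e e0.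
  have bS := step_fun_bounded G n; have mS := step_fun_measurable G n.
  have iS := riesz_integrable bS mS.
  have h1 : `|L (step_fun G n) - L G| <= e * L (fun=> 1).
    by apply: L_dist => // x; rewrite distrC.
  have h2 : `|fine (\int[riesz_measure]_x (G x)%:E) - L (step_fun G n)| <= e * L (fun=> 1).
    rewrite -lee_fin EFinM -riesz_measureT -abse_EFin EFinB fineK // -riesz_step_fun.
    rewrite -integralB_EFin //.
    apply: (@le_trans _ _ (\int[riesz_measure]_x `|(G x - step_fun G n x)%:E|)%E).
      by apply: le_abse_integral => //; apply/measurable_EFinP; exact: measurable_funB.
    rewrite -integral_cst //; apply: ge0_le_integral => //.
    + by apply: measurableT_comp => //; apply/measurable_EFinP; exact: measurable_funB.
    + by move=> x _; rewrite lee_fin hn.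
  rewrite -[_ - L G](subrKA (L (step_fun G n))).
  apply: le_trans (ler_normD _ _) _; apply: le_trans (lerD h2 h1) _.
  by rewrite -mulr2n -[e * _ *+ 2]mulr_natl mulrA.
apply/eqP; rewrite -subr_eq0 -normr_le0; apply/ler_addgt0Pl => e e0; rewrite addr0.
(* The [+ 1] allows for [L 1 = 0]. *)
have C1 : 0 < 2 * (L (fun=> 1) + 1) by lra.
apply: le_trans (key (e / (2 * (L (fun=> 1) + 1))) (divr_gt0 e0 C1)) _.
rewrite mulrA mulrAC ler_pdivrMr //; nra.
Qed.

End Riesz.

(** * Weak limits on [Theta] and the representation theorem *)

(** The values have a cluster point in the compact segment, and a cluster point of an ultrafilter is
    a limit. *)
Lemma ultra_bounded_cvg (R : realType) (I : Type) (W : set_system I) (UW : UltraFilter W)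
    (a : I -> R) (M : R) : (forall i, `|a i| <= M) -> exists l : R, a @ W --> l.
Proof.
move=> aM.
have WT : (a @ W) `[- M, M]%classic.
  have : W setT by exact: filterT.
  by apply: (@filterS _ W) => i _ /=; rewrite in_itv /= -ler_norml.
have [p [_ clp]] := @segment_compact R (- M) M (a @ W) _ WT.
exists p => B nB; have [//|WB] := in_ultra_setVsetC (a @^-1` B) UW.
by have [y [yB By]] := clp (~` B) B WB nB; case: (yB By).
Qed.

Section ThetaMeasurability.
Variable R : realType.

Lemma weakstar_open_gt (g : CC R -> R) (a : R) : {within circle R, continuous g} ->
  weakstar_open [set t : Theta R | a < theta_eval g t].
Proof.
move=> cg t /= at_; exists 1%N, (fun=> g), (theta_eval g t - a); split => //.
split; first by rewrite subr_gt0.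
move=> s /(_ 0%N isT) /=; rewrite ltr_norml => /andP[+ _]; lra.
Qed.

Lemma theta_eval_measurable (g : CC R -> R) : {within circle R, continuous g} ->
  measurable_fun [set: ThetaBorel R] (theta_eval g : ThetaBorel R -> R).
Proof.
move=> cg; apply: measurable_fun_gt => a; apply: sub_sigma_algebra.
exact: weakstar_open_gt.
Qed.

Lemma near_forall_ltn (T : topologicalType) (x : T) n (P : nat -> set T) :
  (forall i, nbhs x (P i)) -> nbhs x [set y | forall i, (i < n)%N -> P i y].
Proof.
move=> nP; elim: n => [|n IH]; first by apply: filterS filterT.
apply: filterS (filterI IH (nP n)) => y [h Pn] i.
by rewrite ltnS leq_eqVlt => /orP[/eqP ->|/h].
Qed.

Lemma weakstar_open_preimage (psi : cantor_space -> Theta R) (A : set (Theta R)) :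
  (forall g, {within circle R, continuous g} -> continuous (fun x => theta_eval g (psi x))) ->
  weakstar_open A -> open (psi @^-1` A).
Proof.
move=> cpsi oA; rewrite openE => x /oA[n [g [e [cg [e0 sA]]]]].
pose P i := [set y | (i < n)%N -> `|theta_eval (g i) (psi y) - theta_eval (g i) (psi x)| < e].
have nP i : nbhs x (P i).
  have [ilt|ige] := ltnP i n; last by apply: filterS filterT => y _ /=; rewrite /P /= ltnNge ige.
  have /cvgrPdist_lt/(_ e e0) := cpsi _ (cg i ilt) x.
  by apply: filterS => y h _; rewrite distrC.
apply: filterS (near_forall_ltn n nP) => y h; apply: sA => i ilt.
exact: h.
Qed.

End ThetaMeasurability.

(** * Weak limits of finite combinations of triples *)

Section WeakLimit.
Variables (R : realType) (I : Type) (W : set_system I).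
Hypothesis UW : UltraFilter W.
Variables (s : I -> seq ({nonneg R} * ctriple R)) (M : R).
Hypothesis s_mass : forall i, \sum_(c <- s i) c.1%:num <= M.

Definition discrete_sum (F : ctriple R -> R) (i : I) : R := \sum_(c <- s i) c.1%:num * F c.2.

Lemma discrete_sum_bounded F B : (forall v, `|F v| <= B) ->
  forall i, `|discrete_sum F i| <= M * B.
Proof.
move=> FB i; have B0 : 0 <= B := le_trans (normr_ge0 _) (FB point).
apply: le_trans (ler_norm_sum _ _ _) _.
apply: (@le_trans _ _ (\sum_(c <- s i) c.1%:num * B)); last first.
  by rewrite -mulr_suml ler_wpM2r.
by apply: ler_sum => c _; rewrite normrM ger0_norm // ler_wpM2l.
Qed.

Definition ultra_sum (F : ctriple R -> R) : R := lim (discrete_sum F @ W).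

Lemma ultra_sum_cvg F : bounded_on F -> discrete_sum F @ W --> ultra_sum F.
Proof.
move=> [B FB]; have [l hl] := ultra_bounded_cvg UW (discrete_sum_bounded FB).
by apply/cvg_ex; exists l.
Qed.

Lemma ultra_sumE F (l : R) : discrete_sum F @ W --> l -> ultra_sum F = l.
Proof. by move=> h; apply: cvg_lim. Qed.

Lemma ultra_sum_add F G : bounded_on F -> bounded_on G ->
  ultra_sum (fun x => F x + G x) = ultra_sum F + ultra_sum G.
Proof.
move=> bF bG; apply: ultra_sumE.
have -> : discrete_sum (fun x => F x + G x) = (fun i => discrete_sum F i + discrete_sum G i).
  by apply/funext => i; rewrite /discrete_sum -big_split; apply: eq_bigr => c _; rewrite mulrDr.
by apply: cvgD; exact: ultra_sum_cvg.
Qed.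

Lemma ultra_sum_scale c F : bounded_on F -> ultra_sum (fun x => c * F x) = c * ultra_sum F.
Proof.
move=> bF; apply: ultra_sumE.
have -> : discrete_sum (fun x => c * F x) = (fun i => c * discrete_sum F i).
  by apply/funext => i; rewrite /discrete_sum mulr_sumr; apply: eq_bigr => k _; rewrite mulrCA.
by apply: cvgM; [exact: cvg_cst | exact: ultra_sum_cvg].
Qed.

Lemma ultra_sum_ge0 F : bounded_on F -> (forall x, 0 <= F x) -> 0 <= ultra_sum F.
Proof.
move=> bF F0; apply: limr_ge; first by apply/cvg_ex; eexists; exact: ultra_sum_cvg.
have : W setT by exact: filterT.
by apply: (@filterS _ W) => i _; apply: sumr_ge0 => c _; rewrite mulr_ge0.
Qed.

(** The ultrafilter limit is read as a functional on the Cantor space, represented there by a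
    measure, and pushed forward along [psi] to [Theta]. *)
Lemma weak_limit : exists nu : {measure set (ThetaBorel R) -> \bar R},
  (forall l : R, discrete_sum (fun=> 1) @ W --> l -> nu setT = l%:E) /\
  forall (g : CC R -> R) (l : R), {within circle R, continuous g} ->
    discrete_sum (fun v => ctriple_eval (set_val v) g) @ W --> l ->
    nu.-integrable setT (fun t => (theta_eval g t)%:E) /\
    l%:E = (\int[nu]_t (theta_eval g t)%:E)%E.
Proof.
have [phi cphi] := @cantor_surj R (ctriple R) (@ctriple_compact R) (@ctriple_hausdorff R).
(* A set-theoretic section, with no regularity: it only moves the finitely many triples of each sum
   to the Cantor space. *)
have /choice[sigma sigmaK] : forall v, exists x, phi x = v.
  by move=> v; have [x _ <-] := @surj _ _ _ _ phi v Logic.I; exists x.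
pose L (F : cantor_space -> R) := ultra_sum (F \o sigma).
have bs F : bounded_on F -> bounded_on (F \o sigma) by move=> [B hB]; exists B => v; exact: hB.
have L_add F G : bounded_on F -> bounded_on G -> L (fun x => F x + G x) = L F + L G.
  by move=> bF bG; apply: ultra_sum_add; exact: bs.
have L_scale (c : R) F : bounded_on F -> L (fun x => c * F x) = c * L F.
  by move=> bF; apply: ultra_sum_scale; exact: bs.
have L_ge0 F : bounded_on F -> (forall x, 0 <= F x) -> 0 <= L F.
  by move=> bF F0; apply: ultra_sum_ge0; [exact: bs | move=> v; exact: F0].
pose mu := riesz_measure L_add L_scale L_ge0.
pose psi (x : cantor_space) : Theta R := to_Theta (phi x).
have cpsi g : {within circle R, continuous g} -> continuous (fun x => theta_eval g (psi x)).
  move=> cg; rewrite /psi; under eq_fun do rewrite to_ThetaE.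
  move=> x; apply: (@continuous_comp _ _ _ phi (fun v => ctriple_eval (set_val v) g)).
    exact: cphi.
  exact: ctriple_eval_continuous.
have mpsi : measurable_fun [set: cantor_borel] (psi : cantor_borel -> ThetaBorel R).
  have E : @measurable _ (ThetaBorel R) = <<s @weakstar_open R >> by [].
  refine (@measurability _ _ cantor_borel (ThetaBorel R) setT psi (@weakstar_open R) E _).
  move=> _ [A oA <-].
  rewrite setTI; apply: cantor_open_measurable; exact: weakstar_open_preimage.
exists (@measure_function_pushforward__canonical__measure_function_Measure
  _ _ cantor_borel (ThetaBorel R) R mu psi mpsi); split.
  move=> l hl; transitivity (mu setT); first by [].
  rewrite riesz_measureT; congr (_%:E).
  exact: ultra_sumE.
move=> g l cg hl.
have [iG eG] := riesz_continuous L_add L_scale L_ge0 (cpsi g cg).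
have mg : measurable_fun [set: ThetaBorel R] (EFin \o (theta_eval g : ThetaBorel R -> R)).
  by apply/measurable_EFinP; exact: theta_eval_measurable.
split; first exact: (integrable_pushforward mpsi mg).
rewrite (integral_pushforward mpsi mg) // preimage_setT [RHS]eG; congr (_%:E).
(* The integrand factors through [phi], and [phi] undoes [sigma], so the choice of the section does
   not affect the value. *)
rewrite -(ultra_sumE hl); congr ultra_sum; apply/funext => v.
by rewrite /= /psi to_ThetaE sigmaK.
Qed.

End WeakLimit.

(** * The Herglotz kernel and the exactly centered sample *)

Section Kernel.
Variable R : realType.

Definition herglotz_kernel (z w : R[i]) : R[i] := (w + z) / (w - z).

Lemma normc_sub_ge (z w : R[i]) : normc w = 1 -> 1 - normc z <= normc (w - z).
Proof. by move=> w1; have := ler_normc_subD w (- z); rewrite normcN w1. Qed.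

Lemma normc_two : normc (2 : R[i]) = 2.
Proof. by have := normc_real (2 : R); rewrite rmorph_nat ger0_norm. Qed.

Lemma herglotz_kernel_bound (z w : R[i]) : normc z < 1 -> normc w = 1 ->
  normc (herglotz_kernel z w) <= 2 / (1 - normc z).
Proof.
move=> z1 w1; have z0 : 0 < 1 - normc z by rewrite subr_gt0.
rewrite /herglotz_kernel normcM normcV; apply: ler_pM.
- exact: normc_ge0.
- by rewrite invr_ge0 normc_ge0.
- by rewrite -[2]/(1 + 1); apply: ler_normcD; rewrite ?w1 // ltW.
- by rewrite lef_pV2 ?posrE ?normc_sub_ge // (lt_le_trans z0) ?normc_sub_ge.
Qed.

(** The difference is exactly [2 z (x - w) / ((w - z) (x - z))], and both factors of the denominator
    are at least [1 - |z|] in modulus. *)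
Lemma herglotz_kernel_lip (z w x : R[i]) : normc z < 1 -> normc w = 1 -> normc x = 1 ->
  normc (herglotz_kernel z w - herglotz_kernel z x) <= 2 / (1 - normc z) ^+ 2 * normc (x - w).
Proof.
move=> z1 w1 x1; have z0 : 0 < 1 - normc z by rewrite subr_gt0.
have wz : w - z != 0 by rewrite neq_normc // w1.
have xz : x - z != 0 by rewrite neq_normc // x1.
have -> : herglotz_kernel z w - herglotz_kernel z x =
    2 * z / ((w - z) * (x - z)) * (x - w).
  by rewrite /herglotz_kernel; field; rewrite wz xz.
rewrite normcM; apply: ler_wpM2r; first exact: normc_ge0.
rewrite !normcM normcV normcM normc_two; apply: ler_pM.
- by rewrite mulr_ge0 ?normc_ge0.
- by rewrite invr_ge0 mulr_ge0 ?normc_ge0.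
- by rewrite ler_piMr // ltW.
- have h1 := normc_sub_ge z w1; have h2 := normc_sub_ge z x1.
  rewrite lef_pV2 ?posrE ?exprn_gt0 ?mulr_gt0 ?(lt_le_trans z0) //.
  by rewrite expr2 ler_pM // ltW.
Qed.

(** Here and below [pr] stands for the real or the imaginary part, so that both are treated by one
    argument. *)
Lemma herglotz_proj_continuous (z : R[i]) (pr : R[i] -> R) : normc z < 1 ->
  (forall x y, `|pr x - pr y| <= normc (x - y)) ->
  {within circle R, continuous (fun w : CC R => pr (herglotz_kernel z w))}.
Proof.
move=> z1 prl; apply/continuous_circleP => w w1 e e0.
have z0 : 0 < 1 - normc z by rewrite subr_gt0.
have C0 : 0 < 2 / (1 - normc z) ^+ 2 by rewrite divr_gt0 // exprn_gt0.
exists (e / (2 / (1 - normc z) ^+ 2)); first by rewrite divr_gt0.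
move=> x x1 xw; apply: le_lt_trans (prl _ _) _.
apply: le_lt_trans (herglotz_kernel_lip z1 w1 x1) _.
by rewrite mulrC -ltr_pdivlMr.
Qed.

Lemma Re_lip (x y : R[i]) : `|complex.Re x - complex.Re y| <= normc (x - y).
Proof.
have := ler_Re_normc (x - y).
by case: x y => [a b] [c d] /=.
Qed.

Lemma Im_lip (x y : R[i]) : `|complex.Im x - complex.Im y| <= normc (x - y).
Proof.
have := ler_Im_normc (x - y).
by case: x y => [a b] [c d] /=.
Qed.

Definition rmean (n : nat) (F : R[i] -> R) : R :=
  (2 ^+ n)^-1 * \sum_(k < 2 ^ n) F (root_unity R n k).

Lemma pow2V_real n : (2 ^+ n)^-1 = ((2 ^+ n)^-1 : R)%:C%C :> R[i].
Proof. by rewrite fmorphV rmorphXn rmorph_nat. Qed.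

Lemma Re_scale (c : R) (x : R[i]) : complex.Re (c%:C%C * x) = c * complex.Re x.
Proof. by case: x => a b /=; rewrite mul0r subr0. Qed.

Lemma Im_scale (c : R) (x : R[i]) : complex.Im (c%:C%C * x) = c * complex.Im x.
Proof. by case: x => a b /=; rewrite mul0r addr0. Qed.

Lemma ReD (x y : R[i]) : complex.Re (x + y) = complex.Re x + complex.Re y.
Proof. by case: x y => [a b] [c d]. Qed.

Lemma ImD (x y : R[i]) : complex.Im (x + y) = complex.Im x + complex.Im y.
Proof. by case: x y => [a b] [c d]. Qed.

Lemma Re_mean n (u : R[i] -> R) (F : R[i] -> R[i]) :
  complex.Re (mean n (fun w => (u w)%:C%C * F w)) = rmean n (fun w => u w * complex.Re (F w)).
Proof.
rewrite /mean pow2V_real Re_scale /rmean; congr (_ * _).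
by elim/big_rec2: _ => // k y x _ <-; rewrite ReD Re_scale.
Qed.

Lemma Im_mean n (u : R[i] -> R) (F : R[i] -> R[i]) :
  complex.Im (mean n (fun w => (u w)%:C%C * F w)) = rmean n (fun w => u w * complex.Im (F w)).
Proof.
rewrite /mean pow2V_real Im_scale /rmean; congr (_ * _).
by elim/big_rec2: _ => // k y x _ <-; rewrite ImD Im_scale.
Qed.

(* The barycenter [b] of the sampled measure is not exactly [0]; an atom of mass [|b|]
   at [- b / |b|] repairs it. *)
Lemma corrected_decomposition n (u : R[i] -> R) : (forall w, normc w = 1 -> 0 <= u w) ->
  exists (s : seq ({nonneg R} * ctriple R)) (a : R[i]), normc a = 1 /\
  forall g : R[i] -> R,
    \sum_(c <- s) c.1%:num * ctriple_eval (set_val c.2) g =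
    rmean n (fun w => u w * g w) + normc (mean n (fun w => (u w)%:C%C * w)) * g a.
Proof.
move=> u0; set b := mean n _.
(* For [b = 0] the extra atom has mass [0], and any point of the circle will do. *)
pose a : R[i] := if b == 0 then 1 else - (b / (normc b)%:C%C).
have nb0 : b != 0 -> normc b != 0 by apply: contra_neq => /eq0_normc.
have a1 : normc a = 1.
  rewrite /a; case: eqP => [_|/eqP b0]; first exact: normc1.
  by rewrite normcN normcM normcV normc_real (ger0_norm (normc_ge0 b)) divff ?nb0.
have ab : (normc b)%:C%C * a = - b.
  rewrite /a; case: eqP => [->|/eqP b0]; first by rewrite normc0 mul0r oppr0.
  by rewrite mulrN mulrCA divff ?mulr1 // fmorph_eq0 nb0.
pose N := (2 ^ n)%N.
pose w (i : 'I_N.+1) := if (i < N)%N then root_unity R n i else a.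
pose p (i : 'I_N.+1) := if (i < N)%N then (2 ^+ n)^-1 * u (root_unity R n i) else normc b.
have w1 i : normc (w i) = 1 by rewrite /w; case: ifP => _ //; exact: normc_root_unity.
have p0 i : 0 <= p i.
  rewrite /p; case: ifP => _; last exact: normc_ge0.
  by rewrite mulr_ge0 ?u0 ?normc_root_unity // invr_ge0 exprn_ge0.
have psum g : \sum_i p i * g (w i) = rmean n (fun w => u w * g w) + normc b * g a.
  rewrite big_ord_recr /= /p /w /= ltnn /rmean mulr_sumr; congr (_ + _).
  by apply: eq_bigr => k _; rewrite ltn_ord mulrA.
have pc : centered w p.
  split; rewrite psum.
    by rewrite -Re_mean -/b -Re_scale ab -ReD subrr.
  by rewrite -Im_mean -/b -Im_scale ab -ImD subrr.
have [s hs] := decomposition w1 p0 pc.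
by exists s, a; split => // g; rewrite -hs psum.
Qed.

End Kernel.

Section IteratedFilter.

(** The threshold for [n] may depend on [m]: the number of roots of unity is chosen after the
    radius. *)
Definition iterated_infty : set_system (nat * nat) :=
  [set A | \forall m \near \oo, \forall n \near \oo, A (m, n)].

Lemma iterated_inftyP (A : set (nat * nat)) : iterated_infty A <->
  exists m0, forall m, (m0 <= m)%N -> exists n0, forall n, (n0 <= n)%N -> A (m, n).
Proof.
split=> [[m0 _ h]|[m0 h]]; exists m0 => // m /h; first by move=> [n0 _ hn]; exists n0.
by move=> [n0 hn]; exists n0.
Qed.

Lemma iterated_infty_proper : ProperFilter iterated_infty.
Proof.
split.
  by move=> /iterated_inftyP[m0 /(_ m0 (leqnn _))[n0 /(_ n0 (leqnn _))]].
split.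
- by apply/iterated_inftyP; exists 0%N => m _; exists 0%N.
- move=> A B /iterated_inftyP[m1 h1] /iterated_inftyP[m2 h2].
  apply/iterated_inftyP; exists (maxn m1 m2) => m; rewrite geq_max => /andP[/h1[n1 k1] /h2[n2 k2]].
  by exists (maxn n1 n2) => n; rewrite geq_max => /andP[/k1 An /k2 Bn].
- move=> A B AB /iterated_inftyP[m1 h1]; apply/iterated_inftyP; exists m1 => m /h1[n1 k1].
  by exists n1 => n /k1; exact: AB.
Qed.

End IteratedFilter.

(** * Approximation of [f] by Herglotz transforms of triples *)

Section Approximation.
Variables (R : realType) (f : CC R -> CC R).
Hypothesis f_diff : forall z, disc R z -> derivable f z 1.
Hypothesis f_pos : forall z, disc R z -> 0 < complex.Re (f z).
Hypothesis f'0 : 'D_1 f 0 = 0.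
Hypothesis f0_gt0 : 0 < f 0.

Lemma disc_normc (z : R[i]) : disc R z <-> normc z < 1.
Proof.
by rewrite /disc /= norm_normc -[1](rmorph1 (real_complex R)) ltcR.
Qed.

Definition radius (m : nat) : R := 1 - m.+2%:R^-1.

Lemma radius_gt0 m : 0 < radius m.
Proof. by rewrite subr_gt0 invf_lt1 ?ltr1n ?ltr0n. Qed.

Lemma radius_lt1 m : radius m < 1.
Proof. by rewrite ltrBlDr ltrDl invr_gt0 ltr0n. Qed.

Lemma radius_cvg (e : R) : 0 < e -> exists m0, forall m, (m0 <= m)%N -> 1 - radius m < e.
Proof.
move=> e0; have := @archi_boundP R e^-1; rewrite invr_ge0 (ltW e0) => /(_ isT).
set N := Num.Def.archi_bound _ => hN; exists N => m Nm.
rewrite /radius subKr invf_plt ?posrE ?ltr0n // (lt_le_trans hN) // ler_nat.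
by rewrite (leq_trans Nm) // leqW // leqW.
Qed.

Lemma f_diff_radius m (x : R[i]) : normc x <= radius m -> derivable f x 1.
Proof. by move=> xr; apply/f_diff/disc_normc/(le_lt_trans xr)/radius_lt1. Qed.

(** In the order of [R[i]] the inequality [0 < f 0] includes that the imaginary part vanishes. *)
Lemma conj_f0 : conjc (f 0) = f 0.
Proof.
move: f0_gt0; case: (f 0) => a b; rewrite ltcE /= => /andP[/eqP -> _].
by rewrite oppr0.
Qed.

Lemma f_radial_cvg (z : R[i]) (e : R) : normc z < 1 -> 0 < e ->
  exists m0, forall m, (m0 <= m)%N -> normc (f ((radius m)%:C%C * z) - f z) < e.
Proof.
move=> z1 e0.
have cf : {for (z : CC R), continuous f}.
  by apply/derivable_continuousC/f_diff/disc_normc.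
have [d d0 dP] := continuous_normcP cf e0.
have [m0 hm] := radius_cvg d0; exists m0 => m /hm rd; apply: dP.
have -> : (radius m)%:C%C * z - z = - ((1 - radius m)%:C%C * z).
  by rewrite (rmorphB _ 1 (radius m)) rmorph1; ring.
have r1 : 0 <= 1 - radius m by rewrite subr_ge0 ltW ?radius_lt1.
rewrite normcN normcM normc_real ger0_norm //.
by apply: le_lt_trans rd; rewrite ler_piMr // ltW.
Qed.

(** A single family [s] serves all [z] and both projections. The error has three parts: moving from
    [f z] to [f (r z)], the sampling in [herglotz_mean], and the atom that repairs the
    barycenter. *)
Lemma herglotz_approximation :
  exists s : nat * nat -> seq ({nonneg R} * ctriple R),
  forall (z : R[i]) (pr : R[i] -> R), normc z < 1 ->
  (forall x y, `|pr x - pr y| <= normc (x - y)) -> (forall x, `|pr x| <= normc x) ->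
  (forall n (u : R[i] -> R) F, pr (mean n (fun w => (u w)%:C%C * F w)) =
     rmean n (fun w => u w * pr (F w))) ->
  forall e : R, 0 < e -> iterated_infty [set i |
    `|pr (f z) - discrete_sum s
        (fun v => ctriple_eval (set_val v) (fun w => pr (herglotz_kernel z w))) i| <= e].
Proof.
pose u m (w : R[i]) : R := complex.Re (f ((radius m)%:C%C * w)).
have u0 m w : normc w = 1 -> 0 <= u m w.
  move=> w1; apply/ltW/f_pos/disc_normc.
  by rewrite normcM w1 mulr1 normc_real ger0_norm ?radius_lt1 // ltW ?radius_gt0.
have /choice[s sP] : forall i : nat * nat, exists s : seq ({nonneg R} * ctriple R),
    exists a : R[i], normc a = 1 /\ forall g : R[i] -> R,
    \sum_(c <- s) c.1%:num * ctriple_eval (set_val c.2) g =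
    rmean i.2 (fun w => u i.1 w * g w) + normc (mean i.2 (fun w => (u i.1 w)%:C%C * w)) * g a.
  by move=> [m n]; exact: corrected_decomposition (u0 m).
exists s => z pr z1 prl prb prM e e0; apply/iterated_inftyP.
have e3 : 0 < e / 3 by rewrite divr_gt0.
have z0 : 0 < 1 - normc z by rewrite subr_gt0.
pose B := 2 / (1 - normc z).
have B0 : 0 < B by rewrite divr_gt0.
have [m0 hm] := f_radial_cvg z1 e3; exists m0 => m /hm h1.
have [n1 h2] := herglotz_mean (@f_diff_radius m) (radius_gt0 m) z1 conj_f0 e3.
(* The mass of the extra atom is compared with [e3 / B], since the kernel is bounded by [B] wherever
   that atom lies on the circle. *)
have [n2 h3] := mean_barycenter (@f_diff_radius m) (radius_gt0 m) f'0 (divr_gt0 e3 B0).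
exists (n1 + n2)%N => n hn.
have {hn}[n1n n2n] : (n1 <= n)%N /\ (n2 <= n)%N by clear -hn; split; lia.
have {}h2 := h2 n n1n; have {}h3 := h3 n n2n.
have [a [a1 sE]] := sP (m, n); rewrite /= /discrete_sum sE /=.
have t2 : `|pr (f ((radius m)%:C%C * z)) -
    rmean n (fun w => u m w * pr (herglotz_kernel z w))| <= e / 3.
  by rewrite -prM distrC; apply: le_trans (prl _ _) h2.
have t3 : `|normc (mean n (fun w => (u m w)%:C%C * w)) * pr (herglotz_kernel z a)| <= e / 3.
  rewrite normrM (ger0_norm (normc_ge0 _)) -[leRHS](divfK (x := B)) ?gt_eqF //.
  apply: ler_pM => //; first exact: normc_ge0.
  exact: le_trans (prb _) (herglotz_kernel_bound z1 a1).
have t1 : `|pr (f z) - pr (f ((radius m)%:C%C * z))| <= e / 3.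
  by rewrite distrC; apply: le_trans (prl _ _) (ltW h1).
move: t1 t2 t3; rewrite !ler_norml => /andP[? ?] /andP[? ?] /andP[? ?].
by apply/andP; split; lra.
Qed.

End Approximation.

Theorem mainTheorem6 (R : realType) (f : CC R -> CC R) :
  (forall z, disc R z -> derivable f z 1) ->
  (forall z, disc R z -> 0 < complex.Re (f z)) ->
  'D_1 f 0 = 0 ->
  0 < f 0 ->
  exists nu : {measure set (ThetaBorel R) -> \bar R},
    nu setT = (complex.Re (f 0))%:E /\
    forall z, disc R z ->
      [/\ nu.-integrable setT (fun t : ThetaBorel R => (complex.Re (h_theta t z))%:E),
          nu.-integrable setT (fun t : ThetaBorel R => (complex.Im (h_theta t z))%:E),
          (complex.Re (f z))%:E = (\int[nu]_t (complex.Re (h_theta t z))%:E)%E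
        & (complex.Im (f z))%:E = (\int[nu]_t (complex.Im (h_theta t z))%:E)%E].
Proof.
move=> f_diff f_pos f'0 f0.
have [s sP] := herglotz_approximation f_diff f_pos f'0 f0.
have [W [UW FW]] := ultraFilterLemma iterated_infty_proper.
(* At [z = 0] the kernel is [1], so the approximation of [f 0] is a statement about total masses; it
   gives both their boundedness and the exact mass of [nu]. *)
have kernel0 : (fun v : ctriple R => ctriple_eval (set_val v)
    (fun w => complex.Re (herglotz_kernel 0 w))) = (fun=> 1).
  apply/funext => v; have [vc _ vs _ _] := set_valP v; rewrite -vs; apply: eq_bigr => j _.
  have v1 : normc (vertex (set_val v) j) = 1 by rewrite /= vc sqrtr1.
  rewrite /herglotz_kernel addr0 subr0 divff ?mulr1 //.
  by apply/eqP => v0; move: v1; rewrite v0 normc0 => /eqP; rewrite eq_sym oner_eq0.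
have n0 : normc (0 : R[i]) < 1 by rewrite normc0.
pose mass := discrete_sum s (fun=> 1).
have massE i : mass i = \sum_(c <- s i) c.1%:num by apply: eq_bigr => c _; rewrite mulr1.
pose M := complex.Re (f 0) + 1.
(* Only eventually is the total mass bounded by [M]. *)
pose s' i := if mass i <= M then s i else [::].
have s'_mass i : \sum_(c <- s' i) c.1%:num <= M.
  rewrite /s'; case: ifP => [|_]; first by rewrite massE.
  rewrite big_nil addr_ge0 // ltW // f_pos //.
  exact/disc_normc.
have Ws : W [set i | s' i = s i].
  (* The tolerance [1] matches the [+ 1] in [M]. *)
  have /FW : iterated_infty [set i | `|complex.Re (f 0) - mass i| <= 1].
    have := sP 0 _ n0 (@Re_lip R) (@ler_Re_normc R) (@Re_mean R) 1 ltr01.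
    by rewrite kernel0.
  apply: filterS => i /=; rewrite ler_norml /s' /M => /andP[h _].
  by rewrite ifT //; lra.
have lim_s' z (pr : R[i] -> R) : normc z < 1 ->
    (forall x y, `|pr x - pr y| <= normc (x - y)) -> (forall x, `|pr x| <= normc x) ->
    (forall n (u : R[i] -> R) F, pr (mean n (fun w => (u w)%:C%C * F w)) =
       rmean n (fun w => u w * pr (F w))) ->
    discrete_sum s' (fun v => ctriple_eval (set_val v) (fun w => pr (herglotz_kernel z w)))
      @ W --> pr (f z).
  move=> z1 p1 p2 p3; apply/cvgrPdist_le => e e0.
  have /FW := sP z pr z1 p1 p2 p3 e e0; apply: filterS2 Ws => i /= s's.
  by rewrite /discrete_sum s's.
have [nu [nuT nuI]] := weak_limit UW s'_mass.
exists nu; split.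
  apply: nuT; have := lim_s' 0 _ n0 (@Re_lip R) (@ler_Re_normc R) (@Re_mean R).
  by rewrite kernel0.
move=> z /disc_normc z1.
have [iR eR] := nuI _ _ (herglotz_proj_continuous z1 (@Re_lip R))
  (lim_s' z _ z1 (@Re_lip R) (@ler_Re_normc R) (@Re_mean R)).
have [iI eI] := nuI _ _ (herglotz_proj_continuous z1 (@Im_lip R))
  (lim_s' z _ z1 (@Im_lip R) (@ler_Im_normc R) (@Im_mean R)).
have hR t : complex.Re (h_theta t z) =
    theta_eval (fun w : CC R => complex.Re (herglotz_kernel z w)) t by exact: theta_Re.
have hI t : complex.Im (h_theta t z) =
    theta_eval (fun w : CC R => complex.Im (herglotz_kernel z w)) t by exact: theta_Im.
split.
- by under eq_fun do rewrite hR.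
- by under eq_fun do rewrite hI.
- by rewrite eR; apply: eq_integral => t _; rewrite hR.
- by rewrite eI; apply: eq_integral => t _; rewrite hI.
Qed.
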